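(* Let $k_0\ge 3$ be an integer and $\lambda>0$. Consider the random walk on the growing complete graph with parameters $k_0$ and $\lambda$ (defined in the context), and for each integer $T\ge1$ let $N_T$ be the number of vertices visited at least once by the walker up to time $T$. Let $\mathcal{G}$ be a standard Gaussian random variable and $d_W$ the Wasserstein distance (of order $1$) between laws of real random variables. Then there is a constant $C$, independent of $T$ (possibly depending on $k_0$ and $\lambda$), such that for all integers $T\ge1$, $$d_W\left(\frac{N_T-\mathbb{E}[N_T]}{\sqrt{\mathrm{Var}(N_T)}},\,\mathcal{G}\right)\le\frac{C}{\sqrt{T}}.$$ In particular, $\frac{N_T-\mathbb{E}[N_T]}{\sqrt{\mathrm{Var}(N_T)}}$ converges in distribution to a standard normal random variable as $T\to\infty$.
   Context: Model (random walk on the growing complete graph). At time $0$ there are $k_0\ge 3$ vertices $v_1,\dots,v_{k_0}$ forming a complete graph, and a walker sits at one of these vertices (fixed). For each $t\in\{1,2,\dots\}$, a new vertex $v_{k_0+t}$ is created at time $t$ and joined to all present vertices; thus during the time interval $[t-1,t)$ the graph is the complete graph on $v_1,\dots,v_{k_0+t-1}$. The walker moves at random times: the times between successive moves (and up to the first move) are i.i.d. exponential with mean $1/\lambda$, so the move times form a Poisson process of rate $\lambda$; in particular the numbers $M_t$ of moves in $[t-1,t)$, $t\ge1$, are independent Poisson random variables with parameter $\lambda$. At each move the walker jumps to a vertex chosen uniformly at random among the vertices present at that time other than her current vertex, independently of the move times and of the past given her current position. The starting vertex counts as visited. The Wasserstein distance is $d_W(X,Y)=\sup_h|\mathbb{E}h(X)-\mathbb{E}h(Y)|$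 over all $1$-Lipschitz $h:\mathbb{R}\to\mathbb{R}$. *)

(* Defs.v *)
From HB Require Import structures.
From mathcomp Require Import all_boot all_order all_algebra.
From mathcomp Require Import all_classical all_reals all_analysis.
Import Order.TTheory GRing.Theory Num.Theory.
Import numFieldNormedType.Exports.

Set Implicit Arguments.
Unset Strict Implicit.
Unset Printing Implicit Defensive.

Local Open Scope classical_set_scope.
Local Open Scope ring_scope.

(* Vertices are numbered from 0: the vertex v_(i+1) of the growing complete
   graph is the natural number i, so the vertices present when there are m of
   them are exactly the naturals below m. *)

Section GrowingWalk.
Context d (Omega : measurableType d) (R : realType) (P : probability Omega R).
Variables (k0 : nat) (lambda : R) (start : nat).
(* [xi 0] is the time up to the first move and [xi i] (i > 0) the time between
   the i-th and the (i+1)-th move; [pos n] is the position after n moves. *)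
Variables (xi : nat -> {RV P >-> R}) (pos : nat -> {RV P >-> nat}).

(* The time of the n-th move for n > 0, and 0 for n = 0. *)
Definition move_time (n : nat) (w : Omega) : R := \sum_(i < n) xi i w.

(* v_(k0+t) is created at time t, so there are k0+t-1 vertices on [t-1, t). *)
Definition nb_present (s : R) : nat := (k0 + Num.truncn s)%N.

(* Uniform law on the vertices present at time s other than u. *)
Definition jump_prob (s : R) (u v : nat) : R :=
  if (v < nb_present s)%N && (v != u) then (nb_present s).-1%:R^-1 else 0.

(* Events determined by all the move times and the first n+1 positions. *)
Definition history (n : nat) : set_system Omega :=
  <<s [set A | (exists i, preimage_set_system setT (xi i) measurable A) \/
               (exists2 j, (j <= n)%N &
                  preimage_set_system setT (pos j) measurable A)] >>.

Definition mutually_independent (Y : nat -> {RV P >-> R}) : Prop :=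
  forall (s : seq nat) (B : nat -> set R), uniq s ->
    (forall i, measurable (B i)) ->
    P (\bigcap_(i in [set` s]) (Y i @^-1` B i)) =
    (\prod_(i <- s) P (Y i @^-1` B i))%E.

Record growing_walk : Prop := GrowingWalk {
  walk_start_present : (start < k0)%N ;
  walk_start : forall w, pos 0 w = start ;
  walk_exponential : forall i (A : set R), measurable A ->
    distribution P (xi i) A = exponential_prob lambda A ;
  walk_independent : mutually_independent xi ;
  (* the conditional law of [pos n.+1] given [history n] is
     [jump_prob (move_time n.+1) (pos n)] *)
  walk_jump : forall n v (A : set Omega), history n A ->
    P (A `&` pos n.+1 @^-1` [set v]) =
    (\int[P]_(w in A) (jump_prob (move_time n.+1 w) (pos n w) v)%:E)%E }.

Definition visited (T : nat) (w : Omega) (v : nat) : Prop :=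
  exists n, move_time n w <= T%:R /\ pos n w = v.

(* The vertices existing at time T are those below k0 + T. *)
Definition nb_visited (T : nat) (w : Omega) : nat :=
  #|[pred v : 'I_(k0 + T) | `[< visited T w v >]]|.

Definition normalized_visited (T : nat) (w : Omega) : R :=
  let N := fun w' => (nb_visited T w')%:R in
  (N w - fine ('E_P[N])%E) / Num.sqrt (fine ('V_P[N])%E).

End GrowingWalk.

Section Distances.
Context d (Omega : measurableType d) (R : realType) (P : probability Omega R).
Context d' (Omega' : measurableType d') (Q : probability Omega' R).

Definition wasserstein (X : Omega -> R) (Y : Omega' -> R) : \bar R :=
  ereal_sup [set (`| 'E_P[h \o X] - 'E_Q[h \o Y] |)%E | h in
    [set h : R -> R | forall x y, `|h x - h y| <= `|x - y|]].

Definition cvg_in_distribution (X : nat -> Omega -> R) (Y : Omega' -> R) :=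
  forall f : R -> R, continuous f -> (exists M : R, forall x, `|f x| <= M) ->
    ('E_P[f \o X n] @[n --> \oo] --> 'E_Q[f \o Y])%E.

Definition standard_gaussian (G : {RV Q >-> R}) : Prop :=
  forall A : set R, measurable A -> distribution Q G A = normal_prob 0 1 A.

End Distances.

(* Main.v *)
Require Import Defs.
From HB Require Import structures.
From mathcomp Require Import all_boot all_order all_algebra.
From mathcomp Require Import all_classical all_reals all_analysis.
From mathcomp Require Import measurable_realfun.
From mathcomp Require Import ring lra zify.
Import Order.TTheory GRing.Theory Num.Theory.
Import numFieldNormedType.Exports.

Set Implicit Arguments.
Unset Strict Implicit.
Unset Printing Implicit Defensive.

Local Open Scope classical_set_scope.
Local Open Scope ring_scope.

(* Let S be a set of vertices not containing the starting one.  As long as the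
   walker has avoided S it sits outside S, so a move made when m vertices are
   present hits S with probability #{v in S present} / (m - 1), whatever the
   position.  Hence the probability that S is not visited up to time T is
   exp (- lambda * sum over v in S of the sum of 1 / (m - 1) over the unit
   intervals before T during which v is present): it factorizes over S.  The
   events "v is not visited", v <> start, are thus independent, and N_T is 1 plus
   a sum of independent Bernoulli variables, whose variance is at least c T
   because the vertices born around time T/4 to T/2 have a survival probability
   bounded away from 0 and 1.  Stein's method bounds the distance to the Gaussian
   by a constant over the standard deviation. *)

(** * Stein's equation *)

(** The numbers of moves in unit intervals never appear. A history contains all the move times;
    given these, avoiding a set costs, at each move, one minus a hit rate that depends only on the
    integer part of the time. The resulting product is averaged one exponential gap at a time, the
    expected answer, an exponential of the integrated rate, turning it into a martingale. Only
    finitely many moves can be treated in this way, so the partial sums of the gaps must be shown to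
    diverge; their Laplace transform gives this with a geometric rate. The avoidance probabilities
    of all sets then determine the joint law of the unvisited vertices by inversion over supersets.
    On the Gaussian side the test functions are merely Lipschitz, so the Stein solution need not
    have a second derivative; a Lipschitz bound on the first one replaces it, and suffices because
    adding or removing one vertex moves the normalized sum by the inverse of the standard deviation.
    Bounded continuous test functions are reached through Lipschitz minorants. *)

Section density.
Local Open Scope ereal_scope.
Context d (T : measurableType d) (R : realType).
Variables (mu nu : {measure set T -> \bar R}) (p : T -> R).
Hypothesis p0 : forall x, (0 <= p x)%R.
Hypothesis mp : measurable_fun setT p.
Hypothesis nuE : forall A, measurable A -> nu A = \int[mu]_(x in A) (p x)%:E.

Import HBNNSimple.

(** For indicators this is [nuE]; linearity gives nonnegative simple functions, and monotone
    convergence along an increasing simple approximation gives the rest. It serves for the Gaussian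
    law, for the exponential gaps and for the jump kernel. *)
Lemma ge0_integral_density (f : T -> \bar R) : measurable_fun setT f ->
  (forall x, 0 <= f x) -> \int[nu]_x f x = \int[mu]_x (f x * (p x)%:E).
Proof.
move=> mf f0.
pose h := nnsfun_approx measurableT mf.
have mpE : measurable_fun setT (EFin \o p) by exact/measurable_EFinP.
have -> : \int[nu]_x f x = lim (\int[nu]_x (EFin \o h n) x @[n --> \oo]).
  have fE x : setT x -> f x = lim ((EFin \o h n) x @[n --> \oo]).
    by move=> Ex; apply/esym/cvg_lim => //; exact: cvg_nnsfun_approx.
  under eq_integral => x /[!inE] /fE -> //.
  apply: monotone_convergence => //.
  - by move=> n; apply/measurable_EFinP.
  - by move=> n x Ex //=; rewrite lee_fin.
  - by move=> x Ex a b ab; rewrite lee_fin; exact/lefP/nd_nnsfun_approx.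
have -> : \int[mu]_x (f x * (p x)%:E) =
    lim (\int[mu]_x ((EFin \o h n) x * (p x)%:E) @[n --> \oo]).
  have fg x : setT x -> f x * (p x)%:E = lim ((EFin \o h n) x * (p x)%:E @[n --> \oo]).
    by move=> Ex; apply/esym/cvg_lim => //; apply: cvgeZr => //; exact: cvg_nnsfun_approx.
  under eq_integral => x /[!inE] /fg -> //.
  apply: (@monotone_convergence _ _ _ _ _ _ (fun n x => (EFin \o h n) x * (p x)%:E)) => //.
  - by move=> n; apply/emeasurable_funM => //; exact/measurable_EFinP.
  - by move=> n x Ex /=; rewrite mule_ge0 ?lee_fin.
  - by move=> x Ex a b ab/=; rewrite lee_wpmul2r ?lee_fin//; exact/lefP/nd_nnsfun_approx.
suff suf n : \int[mu]_x ((EFin \o h n) x * (p x)%:E) = \int[nu]_x (EFin \o h n) x.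
  by under [in RHS]eq_fun do rewrite suf.
under [RHS]eq_integral do rewrite /= fimfunE -fsumEFin//.
have indich m r : measurable_fun setT (fun x => (r * \1_(h m @^-1` [set r]) x)%:E).
  by apply/measurable_EFinP; exact: measurable_funM.
rewrite [RHS]ge0_integral_fsum//; last 2 first.
  - by move=> r; exact: indich.
  - by move=> m y Ey; exact: nnfun_muleindic_ge0.
transitivity (\int[mu]_x (\sum_(y \in range (h n))
    (y * \1_(h n @^-1` [set y]) x)%:E * (p x)%:E)).
  apply: eq_integral => x xE.
  rewrite -ge0_mule_fsuml => [|y]; last exact: nnfun_muleindic_ge0.
  by rewrite fsumEFin // -(fimfunE _ x).
rewrite ge0_integral_fsum//; last 2 first.
  - by move=> y; exact: emeasurable_funM.
  - by move=> m y Ey; rewrite mule_ge0 ?lee_fin// -lee_fin nnfun_muleindic_ge0.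
apply: eq_fsbigr => r rhn.
under [RHS]eq_integral do rewrite EFinM.
rewrite integralZl_indic_nnsfun => //.
under eq_integral do rewrite EFinM -muleA.
rewrite ge0_integralZl//.
- under eq_integral do rewrite muleC.
  rewrite (eq_integral ((EFin \o p) \_ (h n @^-1` [set r]))); last first.
    by move=> x xE; rewrite epatch_indic.
  by rewrite -integral_mkcond -nuE// integral_indic// setIT.
- by apply: emeasurable_funM => //; exact/measurable_EFinP.
- by move=> t Et; rewrite mule_ge0 ?lee_fin.
- by move: rhn; rewrite inE => -[t _ <-]; rewrite lee_fin.
Qed.

Lemma integral_density (f : T -> R) : measurable_fun setT f ->
  \int[nu]_x (f x)%:E = \int[mu]_x (f x * p x)%:E.
Proof.
move=> mf; have mfE : measurable_fun setT (EFin \o f) by exact/measurable_EFinP.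
rewrite integralE [RHS]integralE; congr (_ - _).
- rewrite ge0_integral_density//; last exact: measurable_funepos.
  apply: eq_integral => x _; rewrite !funeposE -!EFin_max -EFinM; congr EFin.
  by rewrite maxr_pMl// mul0r.
- rewrite ge0_integral_density//; last exact: measurable_funeneg.
  apply: eq_integral => x _; rewrite !funenegE -!EFinN -!EFin_max -EFinM; congr EFin.
  by rewrite maxr_pMl// mul0r mulNr.
Qed.

End density.

(** * Growth bounds for the equation [u' = x u + r] *)

Section stein.
Variable R : realType.
Implicit Types (u v f g r h : R -> R) (x y : R).

Lemma eq_cvgn (a b : nat -> R) (l : R) : a =1 b ->
  a n @[n --> \oo] --> l -> b n @[n --> \oo] --> l.
Proof. by move=> /funext ->. Qed.

Lemma is_derive_mul f g x (df dg : R) : is_derive x 1 f df -> is_derive x 1 g dg ->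
  is_derive x 1 (fun y => f y * g y) (df * g x + f x * dg).
Proof.
move=> hf hg; have h := is_deriveM hf hg.
by apply: (is_derive_eq h); rewrite /GRing.scale/=; ring.
Qed.

Lemma is_derive_add f g x (df dg : R) : is_derive x 1 f df -> is_derive x 1 g dg ->
  is_derive x 1 (fun y => f y + g y) (df + dg).
Proof. exact: is_deriveD. Qed.

Lemma is_derive_opp f x (df : R) : is_derive x 1 f df ->
  is_derive x 1 (fun y => - f y) (- df).
Proof. exact: is_deriveN. Qed.

Lemma is_derive_inv f x (df : R) : f x != 0 -> is_derive x 1 f df ->
  is_derive x 1 (fun y => (f y)^-1) (- df / f x ^+ 2).
Proof.
move=> fx0 [dfx <-]; apply: DeriveDef; first exact: derivableV.
by rewrite deriveV// /GRing.scale/=; field.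
Qed.

Lemma is_derive_ge0_le v (dv : R -> R) (a b : R) : a <= b ->
  (forall x, a <= x <= b -> is_derive x 1 v (dv x)) ->
  (forall x, a <= x <= b -> 0 <= dv x) -> v a <= v b.
Proof.
move=> ab hv dv0.
have [||c] := @MVT_segment R v dv a b ab.
- by move=> x; rewrite in_itv/= => /andP[/ltW ax /ltW xb]; apply: hv; rewrite ax.
- apply: derivable_within_continuous => x; rewrite in_itv/= => xab.
  by have [] := hv _ xab.
rewrite in_itv/= => /dv0 c0 vE.
by rewrite -subr_ge0 vE mulr_ge0// subr_ge0.
Qed.

(** The normal density without its constant: its role is that of integrating factor, the derivative
    of [gauss * u] being [gauss * r] when [u' = x u + r]. *)
Definition gauss x : R := expR (- (x ^+ 2 / 2)).

Lemma gauss_gt0 x : 0 < gauss x. Proof. exact: expR_gt0. Qed.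

Lemma gaussN x : gauss (- x) = gauss x.
Proof. by rewrite /gauss sqrrN. Qed.

Lemma is_derive_gauss x : is_derive x 1 gauss (- x * gauss x).
Proof.
have h : is_derive x 1 (fun y : R => - (y ^+ 2 / 2)) (- x).
  have h1 := is_derive_mul (is_derive_id x (1:R)) (is_derive_id x (1:R)).
  have h2 := is_derive_opp (is_derive_mul h1 (is_derive_cst (2^-1 : R) x 1)).
  rewrite (_ : (fun y : R => _) = (fun y : R => - (id y * id y * cst 2^-1 y)))//.
  by apply: (is_derive_eq h2) => /=; field.
by have := is_derive1_comp (is_derive_expR _) h; rewrite mulrC.
Qed.

Lemma gauss_cvg0 : gauss n%:R @[n --> \oo] --> 0.
Proof.
apply: (@squeeze_cvgr _ _ _ _ (fun=> 0) (fun n => n.+1%:R^-1 * 2)); last 2 first.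
- exact: cvg_cst.
- rewrite -[X in _ --> X](mul0r (2 : R)).
  by apply: cvgMl; exact: cvg_harmonic.
near=> n; rewrite ltW ?gauss_gt0//=.
rewrite /gauss expRN mulrC -[leRHS]invrK invfM invrK.
rewrite lef_pV2 ?posrE ?expR_gt0 ?mulr_gt0 ?invr_gt0//.
apply: (le_trans _ (expR_ge1Dx _)).
have : 0 <= (n%:R - 1 : R) ^+ 2 by exact: sqr_ge0.
rewrite -natr1 expr2 ; nra.
Unshelve. all: by end_near. Qed.

(* [al + 2 * rho / (1 + x)] is a supersolution of [u' = x u + al x + rho] on the
   positive half-line, so [gauss * (u - supersolution)] increases to its limit 0. *)
Lemma gauss_barrier_aux u r (al rho : R) : 0 <= al -> 0 <= rho ->
  (forall x, is_derive x 1 u (x * u x + r x)) ->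
  (forall x, 0 <= x -> - r x <= al * x + rho) ->
  gauss n%:R * u n%:R @[n --> \oo] --> 0 ->
  forall x, 0 <= x -> u x <= al + 2 * rho / (1 + x).
Proof.
move=> al0 rho0 du rb ucvg x x0.
pose v y := gauss y * (u y + (- al + - (2 * rho) * (1 + y)^-1)).
pose w y := gauss y * (r y + al * y + 2 * rho * (y / (1 + y) + (1 + y)^-1 ^+ 2)).
have dv y : 0 <= y -> is_derive y 1 v (w y).
  move=> y0; have y1 : 1 + y != 0 by rewrite gt_eqF// ltr_pwDl.
  have h1 : is_derive y 1 (fun y : R => 1 + y) 1.
    have := is_derive_add (is_derive_cst (1 : R) y 1) (is_derive_id y (1:R)).
    by rewrite add0r.
  have h2 := is_derive_mul (is_derive_cst (- (2 * rho) : R) y 1) (is_derive_inv y1 h1).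
  have h3 := is_derive_add (du y) (is_derive_add (is_derive_cst (- al : R) y 1) h2).
  have h4 := is_derive_mul (is_derive_gauss y) h3.
  by apply: (is_derive_eq h4); rewrite /w /=; field.
have dv0 y : 0 <= y -> 0 <= w y.
  move=> y0; rewrite /w; have y1 : 0 < 1 + y by rewrite ltr_pwDl.
  rewrite mulr_ge0 ?(ltW (gauss_gt0 y))//.
  (* The bracket is always at least 1/2; the factor 2 in the barrier makes up for it. *)
  have : rho <= 2 * rho * (y / (1 + y) + (1 + y)^-1 ^+ 2).
    rewrite (_ : 2 * rho * _ = rho * (2 * (y / (1 + y) + (1 + y)^-1 ^+ 2))); last by ring.
    rewrite ler_peMr//.
    rewrite (_ : 2 * _ = 1 + (1 + y ^+ 2) / (1 + y) ^+ 2); last first.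
      by field; rewrite gt_eqF.
    by rewrite lerDl divr_ge0 ?addr_ge0 ?sqr_ge0.
  by have := rb y y0; lra.
have vx n : x <= n%:R -> v x <= v n%:R.
  move=> xn; apply: (@is_derive_ge0_le v w x n%:R xn) => y /andP[xy _].
    by apply: dv; apply: le_trans xy.
  by apply: dv0; apply: le_trans xy.
have vn0 : v n%:R @[n --> \oo] --> 0.
  have h : (gauss n%:R * (- al + - (2 * rho) * (1 + n%:R)^-1)) @[n --> \oo] -->
      0 * (- al + - (2 * rho) * 0).
    apply: cvgM; first exact: gauss_cvg0.
    apply: cvgD; first exact: cvg_cst.
    apply: cvgM; first exact: cvg_cst.
    by apply: eq_cvgn cvg_harmonic => n; rewrite /harmonic/= -natr1 addrC.
  rewrite mul0r in h.
  have h0 := cvgD ucvg h; rewrite addr0 in h0.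
  by apply: (eq_cvgn _ (h0 _)) => n; rewrite /v [RHS]mulrDr.
have : v x <= 0.
  rewrite -(cvg_lim _ vn0)//; apply: limr_ge; first by apply/cvg_ex; exists 0.
  by near=> n; apply: vx; near: n; exact: nbhs_infty_ger.
rewrite /v pmulr_rle0 ?gauss_gt0//.
by rewrite mulNr -opprD subr_le0.
Unshelve. all: by end_near. Qed.

Lemma gauss_barrier_half u r (al rho : R) : 0 <= al -> 0 <= rho ->
  (forall x, is_derive x 1 u (x * u x + r x)) ->
  (forall x, `|r x| <= al * `|x| + rho) ->
  gauss n%:R * u n%:R @[n --> \oo] --> 0 ->
  forall x, 0 <= x -> `|u x| <= al + 2 * rho / (1 + x).
Proof.
move=> al0 rho0 du rb uc x x0; rewrite ler_norml lerNl; apply/andP; split; last first.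
  apply: (gauss_barrier_aux al0 rho0 du) => // y y0.
  by apply: le_trans (ler_norm _) _; rewrite normrN -{2}(ger0_norm y0).
apply: (@gauss_barrier_aux (fun y => - u y) (fun y => - r y) _ _ al0 rho0) => //.
- move=> y; apply: (is_derive_eq (is_derive_opp (du y))).
  by rewrite opprD mulrN.
- move=> y y0; rewrite opprK.
  by apply: le_trans (ler_norm _) _; rewrite -{2}(ger0_norm y0).
- rewrite -oppr0; apply: (eq_cvgn _ (cvgN uc)) => n.
  by rewrite [RHS]mulrN.
Qed.

(** The equation is preserved by [u, r -> - u, - r] and by the reflection replacing [u x] by
    [u (- x)] and [r x] by [- r (- x)], so the one-sided bound on the half-line is enough. The decay
    in [1 + |x|] matters: when [al = 0] it bounds [x u x], hence also [u']. *)
Lemma gauss_barrier u r (al rho : R) : 0 <= al -> 0 <= rho ->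
  (forall x, is_derive x 1 u (x * u x + r x)) ->
  (forall x, `|r x| <= al * `|x| + rho) ->
  gauss n%:R * u n%:R @[n --> \oo] --> 0 ->
  gauss n%:R * u (- n%:R) @[n --> \oo] --> 0 ->
  forall x, `|u x| <= al + 2 * rho / (1 + `|x|).
Proof.
move=> al0 rho0 du rb uc1 uc2 x; have [x0|x0] := leP 0 x.
  by rewrite (ger0_norm x0); apply: gauss_barrier_half uc1 x x0.
rewrite -{1}(opprK x).
rewrite (ltr0_norm x0).
apply: (@gauss_barrier_half (u \o -%R) (fun y => - r (- y)) al rho _ _ _ _ _ (- x)) => //.
- move=> y; have := is_derive1_comp (du (- y)) (is_deriveNid y 1).
  by move=> h; apply: (is_derive_eq h) => /=; ring.
- by move=> y; rewrite normrN -(normrN y).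
- by rewrite oppr_ge0 ltW.
Qed.

End stein.

Section gauss_integrability.
Variable R : realType.
Notation mu := (@lebesgue_measure R).
Implicit Types (x y : R).

Lemma gaussE x : gauss x = (normal_peak 1)^-1 * normal_pdf 0 1 x.
Proof.
rewrite normal_pdfE ?oner_neq0//= mulrA mulVf; last first.
  by rewrite gt_eqF// normal_peak_gt0 ?oner_neq0.
by rewrite mul1r /gauss /normal_fun subr0 expr1n mulNr.
Qed.

Lemma continuous_gauss : continuous (@gauss R).
Proof.
move=> x; have [+ _] := is_derive_gauss x.
by move=> /derivable1_diffP/differentiable_continuous.
Qed.

Lemma measurable_gauss : measurable_fun setT (@gauss R).
Proof. by apply: continuous_measurable_fun; exact: continuous_gauss. Qed.

Lemma integrable_gauss : mu.-integrable setT (EFin \o @gauss R).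
Proof.
rewrite (_ : _ \o _ = (fun x => ((normal_peak 1)^-1)%:E * (normal_pdf 0 1 x)%:E)%E).
  by apply: integrableZl => //; exact: integrable_normal_pdf.
by apply/funext => x /=; rewrite gaussE.
Qed.

(** Up to a constant the dominating function is the normal density of variance 2, because
    [|x| <= 1 + x^2 / 4 <= exp (x^2 / 4)]. *)
Lemma integrable_norm_gauss : mu.-integrable setT (fun x => (`|x| * gauss x)%:E).
Proof.
have s0 : (Num.sqrt 2 : R) != 0 by rewrite gt_eqF// sqrtr_gt0.
apply: (le_integrable measurableT _ _ (integrableZl measurableT
  (normal_peak (Num.sqrt 2))^-1 (integrable_normal_pdf 0 (Num.sqrt 2)))) => /=.
- apply/measurable_EFinP; apply: measurable_funM; last exact: measurable_gauss.
  exact: normr_measurable.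
- move=> x _; rewrite lee_fin.
  rewrite normal_pdfE// mulrA mulVf; last by rewrite gt_eqF// normal_peak_gt0.
  rewrite mul1r /normal_fun subr0 sqr_sqrtr// normrM normr_id.
  rewrite (ger0_norm (ltW (gauss_gt0 x))) (ger0_norm (expR_ge0 _)) /gauss.
  rewrite (_ : - (x ^+ 2 / 2) = - x ^+ 2 / 4 - x ^+ 2 / 4); last by field.
  rewrite expRD mulrCA (_ : 2 *+ 2 = 4 :> R); last by ring.
  rewrite ger_pMr ?expR_gt0// -ler_pdivlMr ?expR_gt0// div1r -expRN opprK.
  apply: le_trans (expR_ge1Dx _).
  have := sqr_ge0 (`|x| - 2); rewrite sqrrB real_normK ?num_real//; lra.
Qed.

Lemma normal_prob_density (f : R -> \bar R) : measurable_fun setT f ->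
  (forall x, 0 <= f x)%E ->
  (\int[normal_prob 0 1]_x f x = \int[mu]_x (f x * (normal_pdf 0 1 x)%:E))%E.
Proof.
move=> mf f0; apply: ge0_integral_density => //.
- by move=> x; exact: normal_pdf_ge0.
- exact: measurable_normal_pdf.
Qed.

End gauss_integrability.

(** * The solution of Stein's equation for a Lipschitz function *)

Section stein_solution.
Variable R : realType.
Notation mu := (@lebesgue_measure R).
Implicit Types x y z : R.
Variables (h : R -> R) (c m : R).
Hypothesis hL : forall x y, `|h x - h y| <= `|x - y|.
Hypothesis m0 : 0 <= m.
Hypothesis hm : forall x, `|h x - c| <= `|x| + m.
Hypothesis hc : (\int[mu]_x ((h x - c) * gauss x)%:E = 0)%E.

Lemma lipschitz1_continuous : continuous h.
Proof.
move=> x; apply/cvgrPdist_le => e e0; near=> y.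
apply: le_trans (hL _ _) _.
near: y; move: e e0; apply/cvgrPdist_le; exact: cvg_id.
Unshelve. all: by end_near. Qed.

Let g x := (h x - c) * gauss x.

Let continuous_g : continuous g.
Proof.
move=> x; apply: cvgM; last exact: continuous_gauss.
by apply: cvgB; [exact: lipschitz1_continuous|exact: cvg_cst].
Qed.

Let measurable_g : measurable_fun setT g.
Proof. exact: continuous_measurable_fun continuous_g. Qed.

Let G x : R := `|x| * gauss x + m * gauss x.

Let gG x : `|g x| <= G x.
Proof.
rewrite /g normrM (ger0_norm (ltW (gauss_gt0 x))) /G -mulrDl.
by rewrite ler_pM2r ?gauss_gt0.
Qed.

Let integrable_G : mu.-integrable setT (EFin \o G).
Proof.
have := integrableD measurableT (@integrable_norm_gauss R)
  (integrableZl measurableT m (@integrable_gauss R)).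
by apply: eq_integrable => // x _.
Qed.

Lemma integrable_stein_rhs :
  mu.-integrable setT (EFin \o (fun x => (h x - c) * gauss x)).
Proof.
apply: (le_integrable measurableT _ _ integrable_G).
  exact/measurable_EFinP.
by move=> x _; rewrite lee_fin (le_trans (gG x))// ler_norm.
Qed.

Let integrable_g : mu.-integrable setT (EFin \o g) := integrable_stein_rhs.

Let F x : R := (\int[mu]_(t in `]-oo, x]) g t)%R.

Let is_derive_F x : is_derive x 1 F (g x).
Proof.
have xx1 : x < x + 1 by rewrite ltrDl.
have [] := @continuous_FTC1 R g -oo%O x _ xx1 _ _ (@continuous_g x).
- by apply: integrableS integrable_g.
- exact: ltNyr.
- by move=> dF FE; apply: DeriveDef => //; rewrite -FE derive1E.
Qed.

Let F_cvg (s : nat -> R) (B : set R) :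
    (forall x, (\1_`]-oo, s n] x : R) @[n --> \oo] --> (\1_B x : R)) -> measurable B ->
  F (s n) @[n --> \oo] --> (\int[mu]_(x in B) g x)%R.
Proof.
move=> sB mB.
have mi A : measurable A -> measurable_fun setT (fun x => (g x * \1_A x)%:E).
  by move=> mA; apply/measurable_EFinP; apply: measurable_funM.
have [||_ _] := @dominated_convergence _ _ _ mu setT measurableT
  (fun n x => (g x * \1_`]-oo, s n] x)%:E) (fun x => (g x * \1_B x)%:E)
  (EFin \o G) (fun n => mi _ (measurable_itv _)) (mi _ mB) _ integrable_G _.
- apply: aeW => x _ /=; apply: cvg_EFin; first by apply: nearW.
  by apply: cvgM; [exact: cvg_cst|exact: sB].
- apply: aeW => x n _ /=; rewrite lee_fin normrM (le_trans _ (gG x))//.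
  by rewrite ler_piMr// indicE; case: (_ \in _); rewrite ?normr1 ?normr0.
have FE A : measurable A -> (\int[mu]_x (g x * \1_A x)%:E = (\int[mu]_(x in A) g x)%:E)%E.
  move=> mA; rewrite /Rintegral fineK; last first.
    by apply: integrable_fin_num => //; apply: integrableS integrable_g.
  rewrite [RHS]integral_mkcond; apply: eq_integral => x _.
  by rewrite patchE indicE; case: (_ \in _); rewrite ?mulr1 ?mulr0.
rewrite FE// => /fine_cvg/=; apply: eq_cvgn => n /=.
by rewrite FE.
Qed.

Let F_cvgNy : F (- n%:R) @[n --> \oo] --> 0.
Proof.
rewrite -(Rintegral_set0 mu g); apply: F_cvg => // x.
rewrite indic0/=; apply: cvg_near_cst; near=> n; apply/eqP.
rewrite indicE memNset//= in_itv/=; apply/negP; rewrite -ltNge ltrNl.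
near: n; exact: nbhs_infty_gtr.
Unshelve. all: by end_near. Qed.

Let F_cvgy : F n%:R @[n --> \oo] --> 0.
Proof.
rewrite (_ : 0 = \int[mu]_(x in setT) g x); last by rewrite /Rintegral hc.
apply: F_cvg => // x; apply: cvg_near_cst; near=> n; apply/eqP.
rewrite !indicE !mem_set//= in_itv/=.
near: n; exact: nbhs_infty_ger.
Unshelve. all: by end_near. Qed.

(** Variation of constants for [f' = x f + (h - c)]. Integrating from minus infinity, together with
    the centring [hc], makes [gauss * stein_sol] vanish at both ends, which is the boundary
    condition of the barrier bound. *)
Definition stein_sol x := F x * (gauss x)^-1.
Let f := stein_sol.

Lemma is_derive_stein_sol x : is_derive x 1 f (x * f x + (h x - c)).
Proof.
have g0 : gauss x != 0 by rewrite gt_eqF// gauss_gt0.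
apply: (is_derive_eq (is_derive_mul (is_derive_F x)
  (is_derive_inv g0 (is_derive_gauss x)))).
by rewrite /f /stein_sol /g; field.
Qed.

Lemma stein_sol_le x : `|f x| <= 1 + 2 * m.
Proof.
have fE n : gauss (n : R) * f n = F n.
  by rewrite mulrC /f /stein_sol mulfVK// gt_eqF// gauss_gt0.
apply: (@le_trans _ _ (1 + 2 * m / (1 + `|x|))); last first.
  by rewrite lerD2l ler_pdivrMr ?ltr_pwDl// ler_peMr ?mulr_ge0// lerDl.
apply: (@gauss_barrier R f (fun x => h x - c) 1 m) => //.
- exact: is_derive_stein_sol.
- by move=> y; rewrite mul1r.
- by apply: eq_cvgn F_cvgy => n; rewrite fE.
- by apply: eq_cvgn F_cvgNy => n; rewrite -gaussN fE.
Qed.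

Let gauss_bounded_cvg (u : nat -> R) (M : R) : (forall n, `|u n| <= M) ->
  gauss n%:R * u n @[n --> \oo] --> 0.
Proof.
move=> uM; apply/norm_cvg0P.
have h0 : gauss (n%:R : R) * M @[n --> \oo] --> 0.
  by rewrite -[X in _ --> X](mul0r M); apply: cvgMl; exact: gauss_cvg0.
apply: (@squeeze_cvgr _ _ _ _ (fun=> 0) (fun n => gauss (n%:R : R) * M)) => //; last exact: cvg_cst.
near=> n.
by rewrite normr_ge0 normrM (ger0_norm (ltW (gauss_gt0 _))) ler_pM2l ?gauss_gt0 ?uM.
Unshelve. all: by end_near. Qed.

(* The barrier is applied to the increment [f (z + d) - f z] rather than to the
   derivative of [f], because [h] need not be differentiable. *)
Lemma stein_sol_lipschitz x y :
  `|(x * f x + (h x - c)) - (y * f y + (h y - c))| <= 6 * (1 + m) * `|x - y|.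
Proof.
pose d := x - y.
(* Subtracting the equations at [z + d] and [z] gives [u' = z u + r], where [r] is now bounded by a
   multiple of [|d|], without a term growing with [z]. *)
pose u (z : R) := f (z + d) - f z.
pose r (z : R) := d * f (z + d) + (h (z + d) - h z).
have fle (z : R) : `|f z| <= 1 + 2 * m by exact: stein_sol_le.
have rle (z : R) : `|r z| <= 2 * (1 + m) * `|d|.
  rewrite (le_trans (ler_normD _ _))// normrM.
  have := hL (z + d) z; rewrite (addrC z) addrK => h1.
  have := ler_wpM2l (normr_ge0 d) (fle (z + d)); rewrite addrC in h1 * => h2.
  move: h1 h2; rewrite mulrDr mulrDr mulr1 mulrDl (mulrC _ `|d|) => h1 h2; lra.
have du (z : R) : is_derive z 1 u (z * u z + r z).
  have h1 := is_derive_add (is_derive_id z (1:R)) (is_derive_cst d z (1:R)).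
  have h2 := @is_derive1_comp R f (fun y => y + d) z _ _ (is_derive_stein_sol (z + d)) h1.
  have h3 := is_derive_add h2 (is_derive_opp (is_derive_stein_sol z)).
  by apply: (is_derive_eq h3); rewrite /u /r /=; ring.
have ub (z : R) : `|u z| <= 2 * (1 + 2 * m).
  by rewrite (le_trans (ler_normB _ _))// mulr2n mulrDl mul1r lerD.
have uxb := @gauss_barrier R u r 0 (2 * (1 + m) * `|d|) (lexx _) _ du _
  (gauss_bounded_cvg (fun n => ub n%:R)) (gauss_bounded_cvg (fun n => ub (- n%:R))) y.
have -> : (x * f x + (h x - c)) - (y * f y + (h y - c)) = y * u y + r y.
  by rewrite /u /r /d subrKC; ring.
rewrite (le_trans (ler_normD _ _))//.
(* The barrier with [al = 0] bounds [|y u y|] by twice the bound on [r], and [r y] itself is added: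
   4 and 2 make 6. *)
have -> : 6 * (1 + m) * `|x - y| = 2 * (2 * (1 + m) * `|d|) + 2 * (1 + m) * `|d|.
  by rewrite -/d; ring.
rewrite lerD// normrM.
have : `|u y| <= 0 + 2 * (2 * (1 + m) * `|d|) / (1 + `|y|).
  apply: uxb; first by rewrite !mulr_ge0// addr_ge0.
  by move=> z; rewrite mul0r add0r.
rewrite add0r => /(ler_wpM2l (normr_ge0 y))/le_trans; apply.
rewrite mulrCA ler_piMr ?mulr_ge0 ?addr_ge0//.
by rewrite ler_pdivrMr ?ltr_pwDl// mul1r lerDr.
Qed.

End stein_solution.

Section gaussian.
Variable R : realType.
Notation mu := (@lebesgue_measure R).
Notation N01 := (@normal_prob R 0 1).
Implicit Types (x y : R) (h : R -> R).

Lemma integrable_normal_norm : N01.-integrable setT (fun x => `|x|%:E).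
Proof.
have mn : measurable_fun setT (fun x : R => `|x|%:E).
  by apply/measurable_EFinP; exact: normr_measurable.
apply/integrableP; split => //.
under eq_integral do rewrite abse_EFin normr_id.
rewrite normal_prob_density//.
rewrite (_ : (fun x => _) = (fun x => ((normal_peak 1)%:E * (`|x| * gauss x)%:E)))%E; last first.
  apply/funext => x; rewrite -!EFinM gaussE; congr EFin.
  by rewrite mulrCA mulVKf// gt_eqF// normal_peak_gt0 ?oner_neq0.
have /integrableP[_] := integrableZl measurableT (normal_peak 1) (integrable_norm_gauss R).
apply: le_lt_trans; rewrite le_eqVlt; apply/orP; left; apply/eqP.
apply: eq_integral => x _; rewrite gee0_abs// mule_ge0 ?lee_fin ?normal_peak_ge0//.
by rewrite mulr_ge0// ltW// gauss_gt0.
Qed.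

Lemma lipschitz1_measurable h : (forall x y, `|h x - h y| <= `|x - y|) ->
  measurable_fun setT h.
Proof. by move=> /lipschitz1_continuous/continuous_measurable_fun. Qed.

Lemma integrable_normal_lipschitz h : (forall x y, `|h x - h y| <= `|x - y|) ->
  N01.-integrable setT (fun x => (h x)%:E).
Proof.
move=> hL; have mh := lipschitz1_measurable hL.
have N1 : N01.-integrable setT (EFin \o cst `|h 0|).
  by apply: finite_measure_integrable_cst.
apply: (le_integrable measurableT _ _ (integrableD measurableT integrable_normal_norm N1)).
  exact/measurable_EFinP.
move=> x _ /=; rewrite lee_fin [leRHS]ger0_norm ?addr_ge0//.
rewrite -{1}(subrK (h 0) (h x)) (le_trans (ler_normD _ _))// lerD2r.
by have := hL x 0; rewrite subr0.
Qed.

(** One constant serves all [h], since only the first absolute moment [m] of the Gaussian enters: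
    averaging [h x - h y] over a Gaussian [y] gives [|h x - c| <= |x| + m]. *)
Lemma stein_equation : exists2 K : R, 0 < K &
  forall h, (forall x y, `|h x - h y| <= `|x - y|) ->
  exists f f' : R -> R, [/\ forall x, is_derive x 1 f (f' x),
    forall x, f' x - x * f x = h x - fine (\int[N01]_x (h x)%:E) &
    forall x y, `|f' x - f' y| <= K * `|x - y|].
Proof.
pose m : R := \int[N01]_x `|x|.
have m0 : 0 <= m by apply: Rintegral_ge0.
exists (6 * (1 + m)); first by rewrite mulr_gt0 ?ltr_pwDl.
move=> h hL; set c := fine _.
have hi := integrable_normal_lipschitz hL.
have ci a : N01.-integrable setT (EFin \o cst a) by apply: finite_measure_integrable_cst.
have cst1 (a : R) : \int[N01]_x (cst a x) = a.
  by rewrite Rintegral_cst// /= probability_setT mulr1.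
have hm x : `|h x - c| <= `|x| + m.
  have -> : h x - c = \int[N01]_y (h x - h y).
    by rewrite (@RintegralB _ _ _ _ _ (cst (h x)))// cst1.
  have i1 : N01.-integrable setT (EFin \o (fun y => h x - h y)).
    by have := integrableB measurableT (ci (h x)) hi; apply: eq_integrable.
  apply: le_trans (le_normr_Rintegral measurableT i1) _.
  rewrite -[X in X + _]cst1 -RintegralD//; last exact: integrable_normal_norm.
  apply: le_Rintegral => //.
  - by apply/integrable_norm : i1.
  - have := integrableD measurableT (ci `|x|) integrable_normal_norm.
    exact: eq_integrable.
  - by move=> y _; rewrite (le_trans (hL _ _))// (le_trans (ler_normB _ _)).
have hc : (\int[mu]_x ((h x - c) * gauss x)%:E = 0)%E.
  have mh := lipschitz1_measurable hL.
  have E : (\int[N01]_x (h x - c)%:E = 0)%E.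
    under eq_integral do rewrite EFinB.
    rewrite integralB//=; [|exact: ci].
    rewrite integral_cst//= probability_setT mule1 fineK ?subee//.
      exact: integrable_fin_num.
    exact: integrable_fin_num.
  have : (\int[mu]_x ((h x - c) * normal_pdf 0 1 x)%:E = 0)%E.
    rewrite -(@integral_density _ _ _ mu N01 (normal_pdf 0 1) _ _ _ (fun x => h x - c))//.
    - by move=> x; exact: normal_pdf_ge0.
    - exact: measurable_normal_pdf.
    - exact: measurable_funB.
  have p0 : normal_peak 1 != 0 :> R by rewrite gt_eqF// normal_peak_gt0 ?oner_neq0.
  have -> : (fun x => ((h x - c) * normal_pdf 0 1 x)%:E) =
      (fun x => (normal_peak 1)%:E * ((h x - c) * gauss x)%:E)%E.
    by apply/funext => x; rewrite -EFinM gaussE mulrCA mulVKf.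
  rewrite integralZl//; last exact: integrable_stein_rhs hL hm.
  by move/eqP; rewrite mule_eq0 eqe (negbTE p0) => /eqP.
exists (stein_sol h c), (fun x => x * stein_sol h c x + (h x - c)); split.
- exact: is_derive_stein_sol.
- by move=> x; rewrite addrC addKr.
- exact: stein_sol_lipschitz.
Qed.

End gaussian.

(** * Sums of independent Bernoulli variables *)

Section poisson_binomial.
Variables (R : realType) (I : finType) (p : I -> R).
Hypothesis p01 : forall v, 0 <= p v <= 1.
Implicit Types (X Y : {set I}) (v : I) (G H : {set I} -> R).

(** The law of a random subset that contains each [v] independently with probability [p v]. On this
    finite space expectations are plain sums. *)
Definition bern_weight X : R := \prod_v (if v \in X then p v else 1 - p v).

Definition bern_mean G : R := \sum_X bern_weight X * G X.

Lemma bern_weight_ge0 X : 0 <= bern_weight X.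
Proof.
apply: prodr_ge0 => v _; have /andP[p0 p1] := p01 v.
by case: ifP; rewrite ?subr_ge0.
Qed.

Lemma bern_mean_cst (a : R) : bern_mean (fun=> a) = a.
Proof.
rewrite /bern_mean -mulr_suml [X in X * _](_ : _ = 1) ?mul1r//.
rewrite /bern_weight -bigA_distr.
by apply: big1 => v _ /=; rewrite subrKC.
Qed.

Lemma bern_meanD G H : bern_mean (fun X => G X + H X) = bern_mean G + bern_mean H.
Proof. by rewrite /bern_mean -big_split; apply: eq_bigr => X _; rewrite mulrDr. Qed.

Lemma bern_meanZ (a : R) G : bern_mean (fun X => a * G X) = a * bern_mean G.
Proof. by rewrite /bern_mean mulr_sumr; apply: eq_bigr => X _; rewrite mulrCA. Qed.

Lemma bern_meanN G : bern_mean (fun X => - G X) = - bern_mean G.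
Proof. by rewrite /bern_mean -sumrN; apply: eq_bigr => X _; rewrite mulrN. Qed.

Lemma bern_meanB G H : bern_mean (fun X => G X - H X) = bern_mean G - bern_mean H.
Proof. by rewrite bern_meanD bern_meanN. Qed.

Lemma bern_mean_sum (J : finType) (G : J -> {set I} -> R) :
  bern_mean (fun X => \sum_j G j X) = \sum_j bern_mean (G j).
Proof.
by rewrite /bern_mean exchange_big; apply: eq_bigr => X _; rewrite mulr_sumr.
Qed.

Lemma eq_bern_mean G H : G =1 H -> bern_mean G = bern_mean H.
Proof. by move=> GH; apply: eq_bigr => X _; rewrite GH. Qed.

Lemma le_bern_mean G H : (forall X, G X <= H X) -> bern_mean G <= bern_mean H.
Proof. by move=> GH; apply: ler_sum => X _; rewrite ler_wpM2l ?bern_weight_ge0. Qed.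

Lemma ler_norm_bern_mean G : `|bern_mean G| <= bern_mean (fun X => `|G X|).
Proof.
apply: le_trans (ler_norm_sum _ _ _) _; apply: ler_sum => X _.
by rewrite normrM ger0_norm ?bern_weight_ge0.
Qed.

(** Integrates out the coordinate [v]: the sets are paired as [X] and [v |: X] with [v] outside [X],
    and both carry the same weight on the other coordinates. *)
Lemma bern_mean_split v H : bern_mean H =
  \sum_(X : {set I} | v \notin X) (\prod_(u | u != v) (if u \in X then p u else 1 - p u)) *
    (p v * H (v |: X) + (1 - p v) * H X).
Proof.
rewrite /bern_mean (bigID (fun X => v \notin X))/= addrC.
rewrite [X in X + _](reindex_onto (fun X => v |: X) (fun X => X :\ v))/=; last first.
  by move=> X; rewrite negbK => vX; rewrite finset.setD1K.
rewrite [X in X + _](eq_bigl (fun X => v \notin X)); last first.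
  move=> X; rewrite negbK finset.setU11/=; have [vX|vX] := boolP (v \in X).
    by apply/eqP => /finset.setP/(_ v); rewrite !inE eqxx vX.
  by apply/eqP; rewrite finset.setU1K.
rewrite -big_split/=; apply: eq_bigr => X vX.
rewrite /bern_weight (bigD1 v)//= finset.setU11 [X in _ + X * _](bigD1 v)//= (negbTE vX).
rewrite [X in p v * X * _ + _](eq_bigr (fun u => if u \in X then p u else 1 - p u)); last first.
  by move=> u uv; rewrite !inE (negbTE uv).
by ring.
Qed.

(** Integration by parts for one Bernoulli variable: its values 1 and 0 contribute [p (1 - p)] and
    [- (1 - p) p], which leaves a discrete derivative of [G]. *)
Lemma bern_mean_centered v G :
  bern_mean (fun X => ((v \in X)%:R - p v) * G X) =
  p v * (1 - p v) * bern_mean (fun X => G (v |: X) - G (X :\ v)).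
Proof.
rewrite -bern_meanZ !(bern_mean_split v); apply: eq_bigr => X vX.
have XD : X :\ v = X by apply/finset.setDidPl; rewrite disjoint_sym disjoints1.
rewrite finset.setU11 (negbTE vX) finset.setUA finset.setUid finset.setU1K// XD.
by rewrite /=; ring.
Qed.

Definition bern_expect : R := \sum_v p v.
Definition bern_var : R := \sum_v p v * (1 - p v).

(** The only probabilistic identity that Stein's method uses here. Taking [G] constant gives the
    mean, taking [G] the centred cardinality gives the variance. *)
Lemma bern_mean_card_centered G :
  bern_mean (fun X => (#|X|%:R - bern_expect) * G X) =
  \sum_v p v * (1 - p v) * bern_mean (fun X => G (v |: X) - G (X :\ v)).
Proof.
under [RHS]eq_bigr do rewrite -bern_mean_centered.
rewrite -bern_mean_sum; apply: eq_bern_mean => X.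
rewrite -mulr_suml /bern_expect sumrB; congr ((_ - _) * _).
rewrite -sum1_card natr_sum [RHS]big_mkcond/= [LHS]big_mkcond.
by apply: eq_bigr => v _; case: (v \in X).
Qed.

Lemma bern_mean_card : bern_mean (fun X => #|X|%:R) = bern_expect.
Proof.
have := bern_mean_card_centered (fun=> 1); rewrite [RHS]big1; last first.
  by move=> v _; rewrite (eq_bern_mean (H := fun=> 0)) ?bern_mean_cst ?mulr0// => X; rewrite subrr.
rewrite (eq_bern_mean (H := fun X => #|X|%:R - bern_expect)); last by move=> X; rewrite mulr1.
by rewrite bern_meanB bern_mean_cst => /eqP; rewrite subr_eq0 => /eqP.
Qed.

Lemma cardU1B v X : #|v |: X|%:R - #|X :\ v|%:R = 1 :> R.
Proof.
have -> : v |: X = v |: (X :\ v) by apply/finset.setP => u; rewrite !inE; case: eqP.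
by rewrite cardsU1 !inE eqxx/= natrD addrK.
Qed.

Lemma bern_mean_var : bern_mean (fun X => (#|X|%:R - bern_expect) ^+ 2) = bern_var.
Proof.
under eq_bern_mean do rewrite expr2.
rewrite bern_mean_card_centered; apply: eq_bigr => v _.
rewrite (eq_bern_mean (H := fun=> 1)) ?bern_mean_cst ?mulr1// => X.
by rewrite opprB addrA subrK cardU1B.
Qed.

(* The sign is that of the complement: [X] will be the set of unvisited vertices. *)
Definition bern_normalized X : R := (bern_expect - #|X|%:R) / Num.sqrt bern_var.

(** Integration by parts turns the mean of [N f N] into increments of [f] over intervals of length
    [1 / s]. By the mean value theorem each is [f' c / s], and replacing [f' c] by [f' N] costs at
    most [K / s]. *)
Lemma bern_stein (K : R) (f f' : R -> R) : 0 < bern_var ->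
  (forall x : R, is_derive x 1 f (f' x)) ->
  (forall x y, `|f' x - f' y| <= K * `|x - y|) ->
  `|bern_mean (fun X => f' (bern_normalized X) - bern_normalized X * f (bern_normalized X))|
    <= K / Num.sqrt bern_var.
Proof.
move=> v0 df f'K; set s := Num.sqrt bern_var; pose N := bern_normalized.
have s0 : 0 < s by rewrite sqrtr_gt0.
have ss : s ^+ 2 = bern_var by rewrite sqr_sqrtr// ltW.
have K0 : 0 <= K by have := f'K 1 0; rewrite subr0 normr1 mulr1; apply: le_trans.
have NE v X : N (X :\ v) = N (v |: X) + s^-1.
  rewrite /N /bern_normalized -/s.
  have -> : #|X :\ v|%:R = #|v |: X|%:R - 1 :> R by have := cardU1B v X; lra.
  by ring.
have E1 : bern_mean (fun X => N X * f (N X)) =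
    \sum_v p v * (1 - p v) * s^-1 * bern_mean (fun X => f (N (X :\ v)) - f (N (v |: X))).
  rewrite (eq_bern_mean (H := fun X => (#|X|%:R - bern_expect) * (- s^-1 * f (N X)))); last first.
    by move=> X; rewrite {1}/N /bern_normalized -/s; ring.
  rewrite bern_mean_card_centered; apply: eq_bigr => v _.
  rewrite -(mulrA (p v * (1 - p v))) -(bern_meanZ s^-1); congr (_ * _).
  by apply: eq_bern_mean => X; ring.
(* The numbers [p v (1 - p v) / s^2] sum to 1, which allows a comparison with the previous sum term
   by term. *)
have E2 : bern_mean (fun X => f' (N X)) =
    \sum_v p v * (1 - p v) * s^-1 * bern_mean (fun X => s^-1 * f' (N X)).
  rewrite -mulr_suml -mulr_suml bern_meanZ -/bern_var -ss; field.
  by rewrite gt_eqF.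
rewrite bern_meanB E1 E2 -sumrB.
apply: le_trans (ler_norm_sum _ _ _) _.
apply: (@le_trans _ _ (\sum_v p v * (1 - p v) * s^-1 * (K * s^-1 * s^-1))); last first.
  rewrite -mulr_suml -mulr_suml -/bern_var -ss le_eqVlt; apply/orP; left; apply/eqP; field.
  by rewrite gt_eqF.
apply: ler_sum => v _; have /andP[p0 p1] := p01 v.
rewrite -mulrBr normrM ger0_norm; last by rewrite !mulr_ge0 ?subr_ge0 ?invr_ge0 ?(ltW s0).
rewrite ler_wpM2l//; first by rewrite !mulr_ge0 ?subr_ge0 ?invr_ge0 ?(ltW s0).
rewrite -bern_meanB; apply: le_trans (ler_norm_bern_mean _) _.
rewrite -[leRHS]bern_mean_cst; apply: le_bern_mean => X.
rewrite NE; set y := N (v |: X).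
have ys : y <= y + s^-1 by rewrite lerDl invr_ge0 ltW.
have cf : {within `[y, y + s^-1], continuous f}.
  by apply: derivable_within_continuous => x _; have [] := df x.
have [c] := MVT_segment ys (fun x _ => df x) cf.
rewrite in_itv/= addrAC subrr add0r => /andP[yc cy] ->.
(* According to whether [v] lies in [X], [N X] is one or the other end of the interval containing
   [c]. *)
have ab : `|f' c - f' (N X)| <= K * s^-1.
  apply: le_trans (f'K _ _) _; rewrite ler_wpM2l//.
  have : N X = y \/ N X = y + s^-1.
    have [vX|vX] := boolP (v \in X); [left|right; rewrite -NE].
      by rewrite /y (finset.setUidPr _)// finset.sub1set.
    by rewrite (finset.setDidPl _)// disjoint_sym disjoints1.
  by case=> ->; rewrite ler_norml; lra.
rewrite (_ : _ - _ = (f' c - f' (N X)) * - s^-1); last by ring.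
by rewrite normrM normrN [`|s^-1|]ger0_norm ?invr_ge0 ?(ltW s0)// ler_wpM2r ?invr_ge0 ?(ltW s0).
Qed.

End poisson_binomial.

(** * Exponential gaps *)

Section measurable_countable_cases.
Context d d' (T : measurableType d) (U : measurableType d').

Lemma measurable_fun_nat (k : T -> nat) :
  (forall n, measurable [set t | k t = n]) -> measurable_fun setT k.
Proof.
move=> mk _ Y _; rewrite setTI.
rewrite (_ : _ @^-1` _ = \bigcup_(n in Y) [set t | k t = n]).
  by apply: bigcup_measurable => n _; exact: mk.
by apply/seteqP; split => [t Yt|t [n Yn] /= kn]; [exists (k t)|rewrite kn].
Qed.

Lemma measurable_fun_cases (k : T -> nat) (f : nat -> T -> U) :
  measurable_fun setT k -> (forall n, measurable_fun setT (f n)) ->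
  measurable_fun setT (fun t => f (k t) t).
Proof.
move=> mk mf _ Y mY; rewrite setTI.
rewrite (_ : _ @^-1` _ = \bigcup_n (k @^-1` [set n] `&` f n @^-1` Y)).
  apply: bigcup_measurable => n _; apply: measurableI.
    by rewrite -[X in measurable X]setTI; exact: mk.
  by rewrite -[X in measurable X]setTI; exact: mf.
by apply/seteqP; split => [t Yt|t [n _] /= [kn]]; [exists (k t)|rewrite kn].
Qed.

End measurable_countable_cases.

(** Packages the image measure as an opaque measure with its change of variables. Several later uses
    push along an identity map, to compare one carrier under two sigma-algebras or two displays. *)
Lemma pushforward_measureP d1 d2 (X : measurableType d1) (Y : measurableType d2) (R : realType)
  (mu : {measure set X -> \bar R}) (f : X -> Y) : measurable_fun setT f ->
  exists nu : {measure set Y -> \bar R},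
    (forall A, nu A = mu (f @^-1` A)) /\
    (forall g : Y -> \bar R, measurable_fun setT g -> (forall y, 0 <= g y)%E ->
      \int[nu]_y g y = \int[mu]_x g (f x))%E.
Proof.
move=> mf.
pose nu : {measure set Y -> \bar R} :=
  measure_function_pushforward__canonical__measure_function_Measure mu mf.
exists nu; split => // g mg g0.
by rewrite (ge0_integral_pushforward mf).
Qed.

Section shift.
Variable R : realType.
Notation mu := (@lebesgue_measure R).
Implicit Types x y : R.

Lemma measurable_truncn : measurable_fun setT (Num.truncn : R -> nat).
Proof.
apply: measurable_fun_nat => -[|n].
  rewrite (_ : [set t | _] = `]-oo, 1%:R[%classic); first exact: measurable_itv.
  apply/seteqP; split => t /=; rewrite in_itv/= -(truncn_le_nat t 0) leqn0 => /eqP//.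
rewrite (_ : [set t | _] = `[n.+1%:R, n.+2%:R[%classic); first exact: measurable_itv.
apply/seteqP; split => t /=; rewrite in_itv/=.
  by move=> tn; rewrite -truncn_gt_nat -truncn_le_nat tn ?leqnn.
by rewrite -truncn_gt_nat -truncn_le_nat => nk; apply/eqP; rewrite eqn_leq andbC.
Qed.

(** The image of Lebesgue measure under a translation agrees with it on half-open intervals, hence
    everywhere by uniqueness. *)
Lemma ge0_integral_shift (f : R -> \bar R) (s : R) : measurable_fun setT f ->
  (forall x, (0 <= f x)%E) -> (\int[mu]_x f (s + x)%R = \int[mu]_x f x)%E.
Proof.
move=> mf f0.
have ms : measurable_fun setT (fun x : measurableTypeR R => (s + x : measurableTypeR R)).
  by apply: measurable_funD => //.
have [nu [nuE nui]] := pushforward_measureP mu ms.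
have muE A : measurable A -> mu A = nu A.
  apply: lebesgue_measure_unique => _ [[a b] _ <-] /=.
  rewrite nuE (_ : _ @^-1` _ = `]a - s, b - s]%classic); last first.
    by apply/seteqP; split => x /=; rewrite !in_itv/= ltrBlDl lerBrDl.
  rewrite lebesgue_measure_itv [RHS]lebesgue_measure_itv/= !lte_fin ltrD2r.
  case: ifP => // _.
  by rewrite -!EFinB; congr EFin; ring.
rewrite [RHS](eq_measure_integral nu); first by rewrite nui.
by move=> A mA _; exact: muE.
Qed.

End shift.

(** * Survival under a piecewise constant hazard *)

Section survival.
Variables (R : realType) (lambda : R) (T : nat) (alpha : nat -> R).
Hypothesis lambda0 : 0 < lambda.
Hypothesis alpha01 : forall k, 0 <= alpha k <= 1.
Notation mu := (@lebesgue_measure R).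
Implicit Types s t x y : R.

(** The inequality is not strict because a move at time [T] counts. The value [alpha T] taken there
    sits on a null set and does not enter [cum_hazard]. *)
Definition hazard t : R := if t <= T%:R then alpha (Num.truncn t) else 0.

(** The integral of [hazard] over [[t, T]] when [t] lies in [[k, k + 1)] and [k < T]. Passing the
    integer part separately keeps it affine in [t], so it can be differentiated. *)
Definition cum_hazard (k : nat) t : R :=
  alpha k * (k.+1%:R - t) + \sum_(k.+1 <= j < T) alpha j.

(** For [t >= 0], the probability that a Poisson process of rate [lambda], each point at time [s]
    being marked with probability [hazard s], has no mark after [t]. *)
Definition survival t : R :=
  if T%:R <= t then 1 else expR (- lambda * cum_hazard (Num.truncn t) t).

Lemma hazard01 t : 0 <= hazard t <= 1.
Proof. by rewrite /hazard; case: ifP => // _; rewrite lexx ler01. Qed.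

Lemma measurable_hazard : measurable_fun setT hazard.
Proof.
apply: measurable_fun_ifT => //=; first exact: measurable_fun_ler.
exact: (measurable_fun_cases (f := fun n _ => alpha n) (@measurable_truncn R)).
Qed.

Lemma measurable_survival : measurable_fun setT survival.
Proof.
apply: measurable_fun_ifT => //=; first exact: measurable_fun_ler.
apply: (measurable_fun_cases (f := fun n t => expR (- lambda * cum_hazard n t))
  (@measurable_truncn R)) => n.
apply: measurableT_comp => //; apply: measurable_funM => //.
apply: measurable_funD => //; apply: measurable_funM => //.
exact: measurable_funB.
Qed.

Lemma survival_ge0 t : 0 <= survival t.
Proof. by rewrite /survival; case: ifP => // _; exact: expR_ge0. Qed.

Lemma survival_le1 t : 0 <= t -> survival t <= 1.
Proof.
move=> t0; rewrite /survival; case: ifP => // _.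
rewrite expR_le1 mulNr oppr_le0 mulr_ge0 ?(ltW lambda0)//.
have := truncn_itv t0 => /andP[_ tk].
apply: addr_ge0; last by apply: sumr_ge0 => i _; have /andP[] := alpha01 i.
by apply: mulr_ge0; [have /andP[] := alpha01 (Num.truncn t)|rewrite subr_ge0 ltW].
Qed.

Lemma survival_ge t : T%:R <= t -> survival t = 1.
Proof. by rewrite /survival => ->. Qed.

Lemma survival_nat (k : nat) :
  survival k%:R = expR (- lambda * \sum_(k <= j < T) alpha j).
Proof.
rewrite /survival ler_nat; case: leqP => [Tk|kT].
  by rewrite big_geq// mulr0 expR0.
by rewrite natrK /cum_hazard -natr1 addrAC subrr add0r mulr1 -big_ltn.
Qed.

(** On the cell [[k, k + 1)] with [k < T], [H k] coincides with [exp (- lambda y)] times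
    [survival y], and [- H k] is an antiderivative of the integrand [g] defined next. *)
Let H k y := expR (- lambda * y) * expR (- lambda * cum_hazard k y).
Let g y := lambda * expR (- lambda * y) * ((1 - hazard y) * survival y).

Let g0 y : 0 <= g y.
Proof.
have /andP[_ h1] := hazard01 y.
by rewrite /g !mulr_ge0 ?expR_ge0 ?subr_ge0 ?survival_ge0 ?(ltW lambda0).
Qed.

Let mg : measurable_fun setT g.
Proof.
apply: measurable_funM.
  by apply: measurable_funM => //; apply: measurableT_comp => //.
apply: measurable_funM; last exact: measurable_survival.
by apply: measurable_funB => //; exact: measurable_hazard.
Qed.

Lemma is_derive_expM (a : R) y : is_derive y 1 (fun y => expR (a * y)) (a * expR (a * y)).
Proof.
have h1 := is_derive_mul (is_derive_cst a y 1) (is_derive_id y (1:R)).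
have h2 := @is_derive1_comp R expR (fun y => a * y) y _ _ (is_derive_expR _) h1.
by apply: (is_derive_eq h2); rewrite /=; ring.
Qed.

Let HE k y : H k y = expR (- lambda * cum_hazard k 0) * expR (- lambda * (1 - alpha k) * y).
Proof. by rewrite /H -!expRD; congr expR; rewrite /cum_hazard; ring. Qed.

Let is_derive_H k y : is_derive y 1 (H k) (- (lambda * (1 - alpha k) * H k y)).
Proof.
rewrite HE; have -> : H k = (fun z => expR (- lambda * cum_hazard k 0) *
    expR (- lambda * (1 - alpha k) * z)) by apply/funext => z; rewrite HE.
move: (expR (- lambda * cum_hazard k 0)) => c.
apply: (is_derive_eq (is_derive_mul (is_derive_cst c y 1) (is_derive_expM _ y))).
by rewrite mul0r add0r -[cst c y]/c; ring.
Qed.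

Let continuous_H k : continuous (H k).
Proof.
move=> y; have [+ _] := is_derive_H k y.
by move=> /derivable1_diffP/differentiable_continuous.
Qed.

Let integral_cell (k : nat) s : (k < T)%N -> k%:R <= s -> s < k.+1%:R ->
  (\int[mu]_(y in `[s, k.+1%:R[) (g y)%:E = (H k s)%:E - (H k k.+1%:R)%:E)%E.
Proof.
move=> kT ks sk.
transitivity (\int[mu]_(y in `[s, k.+1%:R[) (lambda * (1 - alpha k) * H k y)%:E)%E.
  apply: eq_integral => y; rewrite inE/= in_itv/= => /andP[sy yk].
  have kE : Num.truncn y = k.
    by apply/eqP; rewrite truncn_eq ?(le_trans _ (le_trans ks sy))// yk (le_trans ks sy).
  have yT : y < T%:R by rewrite (lt_le_trans yk)// ler_nat.
  by rewrite /g /hazard /survival kE (ltW yT) leNgt yT/= /H; congr EFin; ring.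
rewrite integral_itv_bndo_bndc; last first.
  apply/measurable_EFinP/measurable_funTS/measurable_funM => //.
  by apply: continuous_measurable_fun; exact: continuous_H.
have dN y : is_derive y 1 (fun y => - H k y) (lambda * (1 - alpha k) * H k y).
  by apply: (is_derive_eq (is_derive_opp (is_derive_H k y))); rewrite opprK.
have cN : continuous (fun y => - H k y).
  by move=> y; apply: cvgN; exact: continuous_H.
rewrite (@continuous_FTC2 R _ (fun y => - H k y) s k.+1%:R sk).
- by rewrite addeC EFinN oppeK.
- apply: continuous_subspaceT => y; apply: cvgM; first exact: cvg_cst.
  exact: continuous_H.
- split => [y _||]; first by have [] := dN y.
    by apply/cvg_at_right_filter; exact: cN.
  by apply/cvg_at_left_filter; exact: cN.
- by move=> y _; rewrite derive1E; have [_] := dN y.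
Qed.

Let survivalE (k : nat) s : (k < T)%N -> k%:R <= s -> s < k.+1%:R ->
  expR (- lambda * s) * survival s = H k s.
Proof.
move=> kT ks sk; rewrite /survival leNgt (lt_le_trans sk) ?ler_nat//=.
suff -> : Num.truncn s = k by [].
by apply/eqP; rewrite truncn_eq ?(le_trans _ ks)// ks.
Qed.

Let integral_tail s : T%:R <= s ->
  (\int[mu]_(y in `[s, +oo[) (g y)%:E = (expR (- lambda * s))%:E)%E.
Proof.
move=> Ts.
rewrite -integral_itv_obnd_cbnd; last exact/measurable_EFinP/measurable_funTS.
transitivity (\int[mu]_(y in `]s, +oo[) (lambda * expR (- lambda * y))%:E)%E.
  apply: eq_integral => y; rewrite inE/= in_itv/= andbT => sy.
  have Ty : T%:R < y by exact: le_lt_trans sy.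
  by rewrite /g /hazard leNgt Ty/= survival_ge ?ltW// subr0 !mulr1.
have me : measurable_fun setT (fun y => expR (- lambda * y)).
  by apply: measurableT_comp => //; by apply: measurable_funM.
rewrite integral_itv_obnd_cbnd; last first.
  by apply/measurable_EFinP/measurable_funTS; by apply: measurable_funM.
have ce (a : R) : continuous (fun y => expR (a * y)).
  move=> y; have [+ _] := is_derive_expM a y.
  by move=> /derivable1_diffP/differentiable_continuous.
have dN y : is_derive y 1 (fun y => - expR (- lambda * y)) (lambda * expR (- lambda * y)).
  by apply: (is_derive_eq (is_derive_opp (is_derive_expM _ y))); rewrite mulNr opprK.
rewrite (@ge0_continuous_FTC2y R _ (fun y => - expR (- lambda * y)) s 0).
- by rewrite EFinN oppeK add0e.
- by move=> y _; rewrite mulr_ge0 ?expR_ge0// ltW.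
- apply: continuous_subspaceT => y; apply: cvgM; [exact: cvg_cst|exact: ce].
- rewrite -oppr0; apply: cvgN.
  rewrite (_ : (fun y => expR (- lambda * y)) =
    (fun z => expR (- z)) \o (fun z => lambda * z)); last first.
    by apply/funext => y /=; rewrite mulNr.
  apply: (@cvg_comp _ _ _ _ _ _ (pinfty_nbhs R)); last exact: cvgr_expR.
  exact: gt0_cvgMry.
- by move=> y _; have [] := dN y.
- by apply: cvg_at_right_filter; apply: cvgN; exact: ce.
- by move=> y _; rewrite derive1E; have [_] := dN y.
Qed.

(** Induction backwards from [T], one unit cell at a time. The sum telescopes because [H k] at the
    right end [k + 1] equals the value with which the next cell starts. *)
Let integral_survival_aux (i : nat) s : (i <= T)%N -> 0 <= s -> (T - i)%:R <= s ->
  (\int[mu]_(y in `[s, +oo[) (g y)%:E = (expR (- lambda * s) * survival s)%:E)%E.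
Proof.
elim: i s => [|i IH] s iT s0.
  by rewrite subn0 => Ts; rewrite integral_tail// survival_ge// mulr1.
have [/IH ih _|sT ks] := leP (T - i)%:R s; first by apply: ih => //; exact: ltnW.
pose k := (T - i.+1)%N.
have kE : (T - i = k.+1)%N by rewrite /k -subSn.
have kT : (k < T)%N by rewrite /k ltn_subrL (leq_trans _ iT).
rewrite kE in sT.
have sub : `[s, +oo[%classic = `[s, k.+1%:R[ `|` `[k.+1%:R, +oo[.
  by rewrite -itv_bndbnd_setU// bnd_simp ltW.
rewrite sub ge0_integral_setU//=.
- rewrite (integral_cell kT ks sT) IH ?kE//; last exact: ltnW.
  rewrite (survivalE kT ks sT) -EFinB -EFinD; congr EFin.
  by rewrite survival_nat /H /cum_hazard subrr mulr0 add0r subrK.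
- exact/measurable_EFinP/measurable_funTS.
- by move=> y _; rewrite lee_fin.
- apply/disj_setPS => y [] /=; rewrite !in_itv/= andbT => /andP[_ +].
  by move=> /lt_le_trans h /h; rewrite ltxx.
Qed.

(** The equation of the first move: surviving from [s] means that the next move, after an
    exponential time [x], is harmless and that survival holds from [s + x] on. The substitution
    [y = s + x] reduces it to the tail integral of [g]. *)
Lemma integral_survival s : 0 <= s ->
  (\int[mu]_x ((if 0 <= x then (1 - hazard (s + x)) * survival (s + x) else 0) *
     exponential_pdf lambda x)%:E = (survival s)%:E)%E.
Proof.
move=> s0.
pose f y := if s <= y then expR (lambda * s) * g y else 0.
have mf : measurable_fun setT f.
  by apply: measurable_fun_ifT => //; [exact: measurable_fun_ler|apply: measurable_funM].
transitivity (\int[mu]_x (EFin \o f) (s + x)%R)%E.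
  apply: eq_integral => x _; rewrite /= /f lerDl; case: ifP => [x0|]; last by rewrite mul0r.
  rewrite exponential_pdfE// /g mulrDr expRD !mulNr; congr EFin.
  rewrite (expRN (lambda * s)); field.
  by rewrite expR_eq0.
rewrite ge0_integral_shift; [|exact/measurable_EFinP|]; last first.
  by move=> y; rewrite lee_fin /f; case: ifP => // _; rewrite mulr_ge0 ?expR_ge0.
transitivity (\int[mu]_(y in `[s, +oo[) ((expR (lambda * s))%:E * (g y)%:E))%E.
  rewrite [RHS]integral_mkcond; apply: eq_integral => y _.
  rewrite patchE /= /f; case: ifPn => sy; first by rewrite mem_set//= in_itv/= sy.
  by rewrite memNset//= in_itv/= andbT; apply/negP.
rewrite ge0_integralZl//=; last 2 first.
- exact/measurable_EFinP/measurable_funTS.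
- by move=> y _; rewrite lee_fin.
rewrite (@integral_survival_aux T) ?subnn//.
by rewrite -EFinM mulrA mulNr expRN mulfV ?mul1r// expR_eq0.
Qed.

Lemma integral_laplace :
  (\int[mu]_x ((if 0 <= x then expR (- x) else 0) * exponential_pdf lambda x)%:E =
   (lambda / (lambda + 1))%:E)%E.
Proof.
have l1 : 0 < lambda + 1 by rewrite addr_gt0.
transitivity (\int[mu]_x ((lambda / (lambda + 1))%:E * (exponential_pdf (lambda + 1) x)%:E))%E.
  apply: eq_integral => x _; rewrite -EFinM; congr EFin.
  have [x0|x0] := leP 0 x; last by rewrite !lt0_exponential_pdf// !mulr0.
  rewrite !exponential_pdfE// mulrCA mulrA -mulrA -expRD.
  rewrite (_ : - x + - lambda * x = - (lambda + 1) * x); last by ring.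
  by field; rewrite gt_eqF.
rewrite ge0_integralZl//=; last 3 first.
- by apply/measurable_EFinP; exact: measurable_exponential_pdf.
- by move=> x _; rewrite lee_fin exponential_pdf_ge0// ltW.
- by rewrite lee_fin divr_ge0// ltW.
by rewrite integral_exponential_pdf// mule1.
Qed.

End survival.

(** * Independence from a sub-sigma-algebra *)

Section sub_sigma_algebra.
Context d (Omega : measurableType d) (R : realType) (P : probability Omega R).
Variable G : set_system Omega.
Hypothesis Gm : G `<=` measurable.

Lemma g_sigma_algebra_sub_measurable A : <<s G >> A -> measurable A.
Proof. exact: (smallest_sub (@sigma_algebra_measurable _ Omega) Gm). Qed.

Lemma measurable_id_sub :
  measurable_fun setT (fun w : Omega => (w : g_sigma_algebraType G)).
Proof. by move=> _ A mA; rewrite setTI preimage_id; exact: g_sigma_algebra_sub_measurable. Qed.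

Lemma measurable_fun_sub d' (U : measurableType d') (f : Omega -> U) :
  measurable_fun (setT : set (g_sigma_algebraType G)) f ->
  measurable_fun (setT : set Omega) f.
Proof.
move=> mf _ B mB; rewrite setTI; apply: g_sigma_algebra_sub_measurable.
by have := mf measurableT B mB; rewrite setTI.
Qed.

Lemma measurable_fun_sub_gen d' (U : measurableType d') (f : Omega -> U) :
  (forall B, measurable B -> G (f @^-1` B)) ->
  measurable_fun (setT : set (g_sigma_algebraType G)) f.
Proof.
by move=> fG _ B mB; rewrite setTI; apply: sub_sigma_algebra; exact: fG.
Qed.

Lemma mfunP d1 d2 (T1 : measurableType d1) (T2 : measurableType d2) (f : T1 -> T2) :
  measurable_fun setT f -> exists X : {mfun T1 >-> T2}, X = f :> (T1 -> T2).
Proof. by move=> mf; exists (mfun_Sub (mem_set mf)). Qed.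

(** Independence says that the pair formed by [w], seen through [G] only, and [X w] has a product
    law; Tonelli then integrates [X] out. Using the sample point itself as first coordinate avoids
    coding the past as a vector. *)
Lemma integral_independent (X : {RV P >-> R}) (F : g_sigma_algebraType G * R -> \bar R) :
  (forall A B, <<s G >> A -> measurable B ->
    P (A `&` X @^-1` B) = P A * P (X @^-1` B))%E ->
  measurable_fun setT F -> (forall z, 0 <= F z)%E ->
  (\int[P]_w F (w, X w) = \int[P]_w \int[distribution P X]_x F (w, x))%E.
Proof.
move=> indep mF F0.
have [I IE] := mfunP measurable_id_sub.
have mp : measurable_fun setT (fun w : Omega => ((w : g_sigma_algebraType G), X w)).
  by apply: measurable_fun_pair => //; exact: measurable_id_sub.
have [Q [QE Qi]] := pushforward_measureP P mp.
have prodE A : measurable A -> (distribution P I \x distribution P X)%E A = Q A.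
  apply: product_measure_unique => {}A B mA mB.
  by rewrite QE /= /distribution /pushforward IE -indep.
rewrite -(Qi F mF F0) (eq_measure_integral (distribution P I \x distribution P X)%E); last first.
  by move=> A mA _; exact/esym/prodE.
rewrite fubini_tonelli1// /fubini_F/= ge0_integral_distribution//.
- by apply: eq_integral => w _ /=; rewrite IE.
- exact: (measurable_fun_fubini_tonelli_F F).
- by move=> w; apply: integral_ge0.
Qed.

End sub_sigma_algebra.

Section exponential_gaps.
Context d (Omega : measurableType d) (R : realType) (P : probability Omega R).
Variables (xi : nat -> {RV P >-> R}) (lambda : R).
Hypothesis lambda0 : 0 < lambda.
Hypothesis xi_exp : forall i (A : set R), measurable A ->
  distribution P (xi i) A = exponential_prob lambda A.
Hypothesis xi_indep : mutually_independent xi.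

Definition past_gaps (n : nat) : set_system Omega :=
  [set A | exists2 i, (i < n)%N & preimage_set_system setT (xi i) measurable A].

Lemma preimage_set_systemP d' (U : measurableType d') (f : Omega -> U) (A : set Omega) :
  preimage_set_system setT f measurable A <-> exists2 B, measurable B & A = f @^-1` B.
Proof.
by split => [[B mB <-]|[B mB ->]]; exists B => //; rewrite setTI.
Qed.

Lemma past_gaps_measurable n : past_gaps n `<=` measurable.
Proof.
move=> A [i _ /preimage_set_systemP[B mB ->]].
exact: measurable_funPTI.
Qed.

(** Both sides are finite measures in [A]. They agree on cylinders over the first [n] gaps by mutual
    independence, and cylinders form a generating system stable under intersection. *)
Lemma gap_independent n A B : <<s past_gaps n >> A -> measurable B ->
  (P (A `&` xi n @^-1` B) = P A * P (xi n @^-1` B))%E.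
Proof.
move=> sA mB; have mE : measurable (xi n @^-1` B) by exact: measurable_funPTI.
have inS m i : [set` iota 0 m] i = (i < m)%N :> Prop.
  by rewrite /= mem_iota add0n.
pose cyl (C : nat -> set R) := \bigcap_(i in [set` iota 0 n]) (xi i @^-1` C i).
pose G : set_system Omega := [set A | exists2 C : nat -> set R,
  (forall i, measurable (C i)) & A = cyl C].
have Gm : G `<=` measurable.
  move=> _ [C mC ->]; apply: fin_bigcap_measurable => // i _.
  exact: measurable_funPTI.
have sAG : <<s G >> A.
  apply: smallest_sub sA; first exact: smallest_sigma_algebra.
  move=> _ [i ni /preimage_set_systemP[D mD ->]]; apply: sub_sigma_algebra.
  exists (fun j => if j == i then D else setT); first by move=> j; case: ifP.
  apply/seteqP; split => w; rewrite /cyl.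
    by move=> wD j _; rewrite /preimage/=; case: eqP => // ->.
  by move=> /(_ i); rewrite inS ni /preimage/= eqxx; apply.
have p0 : 0 <= fine (P (xi n @^-1` B)) by rewrite fine_ge0.
pose m2 : {measure set Omega -> \bar R} := mscale (NngNum p0) P.
pose m1 : {measure set Omega -> \bar R} := mrestr P mE.
have m2E D : m2 D = (P D * P (xi n @^-1` B))%E.
  by rewrite /m2/= /mscale/= fineK ?fin_num_measure// muleC.
rewrite -m2E -[LHS]/(m1 A).
apply: (g_sigma_algebra_measure_unique G Gm (fun=> setT)) => //.
- move=> _; exists (fun=> setT) => //.
  by apply/seteqP; split.
- by rewrite bigcup_const.
- move=> _ _ [C1 mC1 ->] [C2 mC2 ->]; exists (fun i => C1 i `&` C2 i).
    by move=> i; exact: measurableI.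
  apply/seteqP; split => w /=.
    by move=> [h1 h2] i ni; split; [exact: h1|exact: h2].
  by move=> h; split => i ni; have [] := h i ni.
- move=> _ [C mC ->]; rewrite m2E /m1/= /mrestr.
  pose C' i := if i == n then B else C i.
  have mC' i : measurable (C' i) by rewrite /C'; case: ifP.
  have -> : cyl C `&` xi n @^-1` B = \bigcap_(i in [set` iota 0 n.+1]) (xi i @^-1` C' i).
    apply/seteqP; split => w.
      move=> [h hB] i; rewrite inS ltnS leq_eqVlt /C' /preimage/=.
      move=> /predU1P[->|ni]; first by rewrite eqxx.
      by rewrite ltn_eqF//; apply: h; rewrite inS.
    move=> h; split => [i|].
      rewrite inS => ni; have := h i.
      by rewrite inS /C' /preimage/= (ltn_eqF ni) ltnS ltnW//; apply.
    by have := h n; rewrite inS /C' /preimage/= eqxx; apply.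
  rewrite xi_indep ?iota_uniq// /cyl xi_indep ?iota_uniq//.
  rewrite -{1}addn1 iotaD big_cat big_seq1/= /C' eqxx add0n; congr (_ * _)%E.
  apply: eq_big_seq => i; rewrite mem_iota add0n => ni.
  by rewrite (ltn_eqF ni).
- by move=> _; rewrite /m1/= /mrestr ltey_eq fin_num_measure//; exact: measurableI.
Qed.

End exponential_gaps.

Section gap_weight.
Variables (R : realType) (T : nat) (alpha : nat -> R).
Hypothesis alpha01 : forall k, 0 <= alpha k <= 1.
Implicit Types x : nat -> R.

Definition gap_sum x (n : nat) : R := \sum_(i < n) x i.

(* The factor 0 discards negative gaps, a null event for exponential gaps. *)
Fixpoint gap_weight x (n : nat) : R :=
  if n is n'.+1 then gap_weight x n' *
    (if 0 <= x n' then 1 - hazard T alpha (gap_sum x n) else 0)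
  else 1.

Lemma gap_sumS x n : gap_sum x n.+1 = gap_sum x n + x n.
Proof. exact: big_ord_recr. Qed.

Lemma gap_weight01 x n : 0 <= gap_weight x n <= 1.
Proof.
elim: n => [|n /andP[IH0 IH1]]/=; first by rewrite ler01 lexx.
case: ifP => _; last by rewrite mulr0 lexx ler01.
have /andP[h0 h1] := hazard01 T alpha01 (gap_sum x n.+1).
by rewrite mulr_ge0 ?subr_ge0//= mulr_ile1 ?subr_ge0// gerBl.
Qed.

Lemma gap_weight_neq0 x n : gap_weight x n != 0 -> forall i, (i < n)%N -> 0 <= x i.
Proof.
elim: n => [//|n IH] /=; rewrite mulf_eq0 negb_or => /andP[/IH h +] i.
rewrite ltnS leq_eqVlt => + /predU1P[->|/h//].
by case: ifP => //; rewrite eqxx.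
Qed.

Lemma gap_sum_ge0 x n : (forall i, (i < n)%N -> 0 <= x i) -> 0 <= gap_sum x n.
Proof. by move=> h; apply: sumr_ge0 => i _; exact: h. Qed.

Lemma measurable_gap_sum d (O : measurableType d) (X : nat -> O -> R) n :
  (forall i, (i < n)%N -> measurable_fun setT (X i)) ->
  measurable_fun setT (fun w => gap_sum (X ^~ w) n).
Proof. by move=> mX; apply: measurable_sum => i; exact: mX. Qed.

Lemma measurable_gap_weight d (O : measurableType d) (X : nat -> O -> R) n :
  (forall i, (i < n)%N -> measurable_fun setT (X i)) ->
  measurable_fun setT (fun w => gap_weight (X ^~ w) n).
Proof.
elim: n => [|n IH] mX /=; first exact: measurable_cst.
apply: measurable_funM; first by apply: IH => i ni; apply: mX; exact: ltnW.
apply: measurable_fun_ifT => //=.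
  by apply: measurable_fun_ler => //; exact: mX.
apply: measurable_funB => //.
by apply: (measurableT_comp (measurable_hazard T alpha)); exact: measurable_gap_sum.
Qed.

End gap_weight.

(* [R] and [measurableTypeR R], the carrier of the Lebesgue measure, have distinct displays. *)
Lemma ge0_integral_distribution_density d (Omega : measurableType d) (R : realType)
    (P : probability Omega R) (X : {RV P >-> R}) (p : R -> R) (f : R -> \bar R) :
  (forall x, 0 <= p x) -> measurable_fun setT p ->
  (forall A : set R, measurable A ->
    distribution P X A = \int[@lebesgue_measure R]_(x in A) (p x)%:E)%E ->
  measurable_fun setT f -> (forall x, 0 <= f x)%E ->
  (\int[distribution P X]_x f x = \int[@lebesgue_measure R]_x (f x * (p x)%:E))%E.
Proof.
move=> p0 mp distE mf f0.
have mid : measurable_fun setT (fun x : R => (x : measurableTypeR R)).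
  by move=> _ A mA; rewrite setTI.
have [nu [nuE nui]] := pushforward_measureP (distribution P X) mid.
rewrite -(nui f mf f0); apply: ge0_integral_density => // A mA.
by rewrite nuE; exact: distE.
Qed.

(** * Averaging the product of the survival factors over the gaps *)

Section gap_martingale.
Context d (Omega : measurableType d) (R : realType) (P : probability Omega R).
Variables (xi : nat -> {RV P >-> R}) (lambda : R).
Hypothesis lambda0 : 0 < lambda.
Hypothesis xi_exp : forall i (A : set R), measurable A ->
  distribution P (xi i) A = exponential_prob lambda A.
Hypothesis xi_indep : mutually_independent xi.
Notation mu := (@lebesgue_measure R).
Notation gap w := (fun i => xi i w).

Lemma measurable_past_gap n i : (i < n)%N ->
  measurable_fun (setT : set (g_sigma_algebraType (past_gaps xi n))) (xi i).
Proof.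
move=> ni; apply: measurable_fun_sub_gen => B mB; exists i => //.
by apply/preimage_set_systemP; exists B.
Qed.

(** The hypothesis on [g] makes it an eigenfunction, with eigenvalue [c], of the step that waits an
    exponential time and pays [1 - hazard]. It is used with [survival] and [c = 1], and with
    [exp (- s)], no hazard and [c = lambda / (lambda + 1)]. *)
Lemma gap_weight_step (T : nat) (alpha : nat -> R) (g : R -> R) (c : R) n :
  (forall k, 0 <= alpha k <= 1) ->
  measurable_fun setT g -> (forall s, 0 <= g s) ->
  (forall s, 0 <= s -> (\int[mu]_x ((if 0 <= x then
      (1 - hazard T alpha (s + x)) * g (s + x) else 0) *
     exponential_pdf lambda x)%:E = (c * g s)%:E)%E) ->
  (\int[P]_w (gap_weight T alpha (gap w) n.+1 * g (gap_sum (gap w) n.+1))%:E =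
   \int[P]_w (c * (gap_weight T alpha (gap w) n * g (gap_sum (gap w) n)))%:E)%E.
Proof.
move=> alpha01 mg g0 gE.
have h1 t : 0 <= 1 - hazard T alpha t.
  by have /andP[_] := hazard01 T alpha01 t; rewrite subr_ge0.
pose O := g_sigma_algebraType (past_gaps xi n).
pose f s x := if 0 <= x then (1 - hazard T alpha (s + x)) * g (s + x) else 0.
have f0 s x : 0 <= f s x by rewrite /f; case: ifP => // _; rewrite mulr_ge0.
have D0 w : 0 <= gap_weight T alpha (gap w) n.
  by have /andP[] := gap_weight01 T alpha01 (gap w) n.
pose F (z : O * R) := (gap_weight T alpha (gap z.1) n * f (gap_sum (gap z.1) n) z.2)%:E.
have mh : measurable_fun setT (hazard T alpha) by exact: measurable_hazard.
have mF : measurable_fun setT F.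
  have mt : measurable_fun setT (fun z : O * R => gap_sum (gap z.1) n + z.2).
    apply: measurable_funD => //.
    apply: (measurableT_comp (f := fun w : O => gap_sum (gap w) n)) => //.
    by apply: measurable_gap_sum => i; exact: measurable_past_gap.
  apply/measurable_EFinP; apply: measurable_funM.
    apply: (measurableT_comp (f := fun w : O => gap_weight T alpha (gap w) n)) => //.
    by apply: measurable_gap_weight => i; exact: measurable_past_gap.
  apply: measurable_fun_ifT => //=; first exact: measurable_fun_ler.
  apply: measurable_funM; last exact: measurableT_comp mt.
  by apply: measurable_funB => //; exact: measurableT_comp mt.
transitivity (\int[P]_w F (w, xi n w))%E.
  apply: eq_integral => w _; rewrite /F /f /= gap_sumS; congr EFin.
  by case: ifP => _; rewrite ?mulr0 ?mul0r// mulrA.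
rewrite (integral_independent (past_gaps_measurable (n := n)) _ mF); last 2 first.
- by move=> A B; exact: gap_independent.
- by move=> z; rewrite lee_fin mulr_ge0.
apply: eq_integral => w _.
have mf s : measurable_fun setT (f s).
  apply: measurable_fun_ifT => //=; first exact: measurable_fun_ler.
  have ms : measurable_fun setT (fun x : R => s + x) by exact: measurable_funD.
  apply: measurable_funM; last exact: measurableT_comp ms.
  by apply: measurable_funB => //; exact: measurableT_comp ms.
transitivity (\int[mu]_x (F (w, x) * (exponential_pdf lambda x)%:E))%E.
  apply: ge0_integral_distribution_density => //.
  - by move=> x; rewrite exponential_pdf_ge0// ltW.
  - exact: measurable_exponential_pdf.
  - by move=> A mA; exact: xi_exp.
  - apply/measurable_EFinP; apply: measurable_funM => /=; first exact: measurable_cst.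
    exact: (mf (gap_sum (gap w) n)).
  - by move=> x; rewrite lee_fin mulr_ge0// f0.
(* The equation for [g] is assumed at nonnegative times only; a nonzero weight guarantees that the
   elapsed time is one. *)
have [D00|Dn0] := eqVneq (gap_weight T alpha (gap w) n) 0.
  by rewrite D00 mul0r mulr0; apply: integral0_eq => x _; rewrite /F/= D00 mul0r mul0e.
have s0 := gap_sum_ge0 (gap_weight_neq0 Dn0).
transitivity (\int[mu]_x ((gap_weight T alpha (gap w) n)%:E *
    (f (gap_sum (gap w) n) x * exponential_pdf lambda x)%:E))%E.
  by apply: eq_integral => x _; rewrite /F -!EFinM mulrA.
rewrite ge0_integralZl//=.
- by rewrite gE// -EFinM; congr EFin; ring.
- apply/measurable_EFinP; apply: measurable_funM; first exact: (mf (gap_sum (gap w) n)).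
  exact: measurable_exponential_pdf.
- by move=> x _; rewrite lee_fin mulr_ge0 ?f0 ?exponential_pdf_ge0// ltW.
- by rewrite lee_fin.
Qed.

(* [survival] is the function making this product a martingale in [n]. *)
Lemma gap_weight_survival (T : nat) (alpha : nat -> R) n :
  (forall k, 0 <= alpha k <= 1) ->
  (\int[P]_w (gap_weight T alpha (gap w) n *
     survival lambda T alpha (gap_sum (gap w) n))%:E = (survival lambda T alpha 0)%:E)%E.
Proof.
move=> alpha01; elim: n => [|n IH].
  under eq_integral do rewrite mul1r /gap_sum big_ord0.
  by rewrite integral_cst//= probability_setT mule1.
rewrite (gap_weight_step (c := 1))//.
- by under eq_integral do rewrite mul1r; exact: IH.
- exact: measurable_survival.
- exact: survival_ge0.
- by move=> s s0; rewrite integral_survival// mul1r.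
Qed.

Lemma hazard_cst0 (T : nat) t : hazard T (fun=> 0 : R) t = 0.
Proof. by rewrite /hazard; case: ifP. Qed.

(** With zero hazard the weight is just the indicator of nonnegative gaps. The geometric decay is
    the quantitative form of the divergence of the move times. *)
Lemma gap_weight_laplace n :
  (\int[P]_w (gap_weight 0 (fun=> 0) (gap w) n * expR (- gap_sum (gap w) n))%:E =
   ((lambda / (lambda + 1)) ^+ n)%:E)%E.
Proof.
have me : measurable_fun setT (fun s : R => expR (- s)).
  by apply: measurableT_comp => //; exact: measurable_funN.
have a01 (k : nat) : 0 <= (0 : R) <= 1 by rewrite lexx ler01.
elim: n => [|n IH].
  under eq_integral do rewrite mul1r /gap_sum big_ord0 oppr0 expR0.
  by rewrite integral_cst//= probability_setT mule1.
rewrite (gap_weight_step (c := lambda / (lambda + 1)) (g := fun s => expR (- s)))//.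
- under eq_integral do rewrite EFinM.
  rewrite ge0_integralZl//=; [by rewrite IH -EFinM exprS| | |].
  + apply/measurable_EFinP; apply: measurable_funM.
      by apply: measurable_gap_weight => i _; exact: measurable_funP.
    by apply: (measurableT_comp me); apply: measurable_gap_sum => i _; exact: measurable_funP.
  + move=> w _; rewrite lee_fin mulr_ge0 ?expR_ge0//.
    by have /andP[] := gap_weight01 0 a01 (gap w) n.
  + by rewrite lee_fin divr_ge0 ?ltW// addr_gt0.
- move=> s s0; transitivity (\int[mu]_x ((expR (- s))%:E *
     ((if (0 <= x)%R then expR (- x) else 0%R) * exponential_pdf lambda x)%:E))%E.
    apply: eq_integral => x _; rewrite -EFinM hazard_cst0 subr0 mul1r opprD expRD.
    by case: ifP => _; congr EFin; ring.
  rewrite ge0_integralZl//=.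
  + by rewrite integral_laplace// -EFinM mulrC.
  + apply/measurable_EFinP; apply: measurable_funM; last exact: measurable_exponential_pdf.
    by apply: measurable_fun_ifT => //; exact: measurable_fun_ler.
  + move=> x _; rewrite lee_fin mulr_ge0 ?exponential_pdf_ge0 ?(ltW lambda0)//.
    by case: ifP => // _; exact: expR_ge0.
Qed.

Lemma le_gap_weight (T : nat) (alpha : nat -> R) (x : nat -> R) n :
  (forall k, 0 <= alpha k <= 1) ->
  gap_weight T alpha x n <= gap_weight 0 (fun=> 0) x n.
Proof.
move=> alpha01; elim: n => //= n IH.
have /andP[w0 _] := gap_weight01 T alpha01 x n.
have /andP[h0 h1] := hazard01 T alpha01 (gap_sum x n.+1).
case: ifP => _; last by rewrite !mulr0.
by apply: ler_pM; rewrite ?subr_ge0// hazard_cst0 subr0 gerBl.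
Qed.

(** The weight times [survival] has constant mean, and the two differ only when the elapsed time [s]
    is below [T]. There the indicator is at most [exp (T - s)], so the error is at most [exp T]
    times the [n]-th power of [lambda / (lambda + 1)]. *)
Lemma gap_weight_cvg (T : nat) (alpha : nat -> R) :
  (forall k, 0 <= alpha k <= 1) ->
  (\int[P]_w (gap_weight T alpha (gap w) n)%:E)%E @[n --> \oo] -->
  (survival lambda T alpha 0)%:E.
Proof.
move=> alpha01.
have a01 (k : nat) : 0 <= (0 : R) <= 1 by rewrite lexx ler01.
pose r := lambda / (lambda + 1).
pose D n w := gap_weight T alpha (gap w) n.
pose S n w := survival lambda T alpha (gap_sum (gap w) n).
have mD n : measurable_fun setT (D n).
  by apply: measurable_gap_weight => i _; exact: measurable_funP.
have mt n : measurable_fun setT (fun w => gap_sum (gap w) n).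
  by apply: measurable_gap_sum => i _; exact: measurable_funP.
have mS n : measurable_fun setT (S n).
  by apply: (measurableT_comp (measurable_survival lambda T alpha)).
have D01 n w : 0 <= D n w <= 1 by exact: gap_weight01.
have S0 n w : 0 <= S n w by exact: survival_ge0.
have DS0 n w : 0 <= D n w * S n w by have /andP[? _] := D01 n w; rewrite mulr_ge0.
have DS n w : D n w * S n w <= D n w.
  have [->|Dn0] := eqVneq (D n w) 0; first by rewrite mul0r.
  have s0 := gap_sum_ge0 (gap_weight_neq0 Dn0).
  have /andP[w0 _] := D01 n w.
  by rewrite ler_piMr// survival_le1.
have up n w : D n w <= D n w * S n w +
    expR T%:R * (gap_weight 0 (fun=> 0) (gap w) n * expR (- gap_sum (gap w) n)).
  have wD := le_gap_weight T (gap w) n alpha01.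
  have /andP[w0 _] := D01 n w.
  have [Ts|sT] := leP T%:R (gap_sum (gap w) n).
    by rewrite /S survival_ge// mulr1 lerDl !mulr_ge0 ?expR_ge0// (le_trans w0).
  rewrite -[leLHS]add0r lerD//.
  rewrite mulrCA -expRD (le_trans wD)// ler_peMr ?(le_trans w0)//.
  by rewrite -[leLHS]expR0 ler_expR subr_ge0 ltW.
apply: (@squeeze_cvge _ _ _ _ (fun=> (survival lambda T alpha 0)%:E) _
  (fun n => (survival lambda T alpha 0 + expR T%:R * r ^+ n)%:E)); last 2 first.
- exact: cvg_cst.
- apply: cvg_EFin; first by apply: nearW.
  rewrite -[X in _ --> X]addr0 -[X in _ + X](mulr0 (expR T%:R)).
  apply: cvgD; first exact: cvg_cst.
  apply: cvgM; first exact: cvg_cst.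
  apply: cvg_expr; rewrite ger0_norm ?divr_ge0 ?ltW ?addr_gt0//.
  by rewrite ltr_pdivrMr ?addr_gt0// mul1r ltrDl.
near=> n; apply/andP; split.
  rewrite -(gap_weight_survival T n alpha01); apply: ge0_le_integral => //.
  - by move=> w _; rewrite lee_fin; exact: DS0.
  - by apply/measurable_EFinP; apply: measurable_funM; [exact: mD|exact: mS].
  - by apply/measurable_EFinP; exact: mD.
  - by move=> w _; rewrite lee_fin; exact: DS.
rewrite EFinD EFinM -(gap_weight_survival T n alpha01) -gap_weight_laplace.
have mL : measurable_fun setT
    (fun w => (gap_weight 0 (fun=> 0) (gap w) n * expR (- gap_sum (gap w) n))%:E).
  apply/measurable_EFinP; apply: measurable_funM.
    by apply: measurable_gap_weight => i _; exact: measurable_funP.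
  by apply: measurableT_comp => //; apply: measurable_funN; exact: mt.
have L0 w : 0 <= gap_weight 0 (fun=> 0) (gap w) n * expR (- gap_sum (gap w) n).
  by rewrite mulr_ge0 ?expR_ge0//; have /andP[] := gap_weight01 0 a01 (gap w) n.
rewrite -ge0_integralZl//; last by move=> w _; rewrite lee_fin.
rewrite -ge0_integralD//; last 4 first.
- by move=> w _; rewrite lee_fin; exact: DS0.
- by apply/measurable_EFinP; apply: measurable_funM; [exact: mD|exact: mS].
- by move=> w _; rewrite mule_ge0// lee_fin ?expR_ge0.
- exact: emeasurable_funM.
apply: ge0_le_integral => //.
- by move=> w _; rewrite lee_fin; have /andP[] := D01 n w.
- by apply/measurable_EFinP; exact: mD.
- apply: emeasurable_funD; last exact: emeasurable_funM.
  by apply/measurable_EFinP; apply: measurable_funM; [exact: mD|exact: mS].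
- by move=> w _; rewrite -EFinM -EFinD lee_fin; exact: up.
Unshelve. all: by end_near. Qed.

End gap_martingale.

(** * The law of the set of unvisited vertices *)

Section walk.
Context d (Omega : measurableType d) (R : realType) (P : probability Omega R).
Variables (k0 : nat) (lambda : R) (start : nat).
Variables (xi : nat -> {RV P >-> R}) (pos : nat -> {RV P >-> nat}).
Hypothesis hk0 : (3 <= k0)%N.
Hypothesis lambda0 : 0 < lambda.
Hypothesis W : growing_walk k0 lambda start xi pos.
Variables (T : nat) (A : pred nat).
Hypothesis A_start : ~~ A start.
Hypothesis A_lt : forall v, A v -> (v < k0 + T)%N.
Notation tau := (move_time xi).
Notation gap w := (fun i => xi i w).

Definition hit_rate (k : nat) : R :=
  (\sum_(v < k0 + T | A v) (v < k0 + k)%:R) / (k0 + k).-1%:R.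

(** The vertex [start] is always present and outside [A], so at most [k0 + k - 1] of the [k0 + k]
    vertices present lie in [A]: [start :: s] is a list of present vertices without repetition. *)
Lemma hit_rate01 k : 0 <= hit_rate k <= 1.
Proof.
have k0gt : (0 < (k0 + k).-1)%N.
  by rewrite -subn1 subn_gt0 (leq_trans _ (leq_addr _ _))// (leq_trans _ hk0).
apply/andP; split; first by rewrite divr_ge0// sumr_ge0.
rewrite ler_pdivrMr ?ltr0n// mul1r -natr_sum ler_nat.
have start0 := walk_start_present W.
rewrite -ltnS prednK; last by rewrite (leq_trans _ (leq_addr _ _))// (leq_trans _ hk0).
pose s := map (@nat_of_ord (k0 + T))
    [seq v : 'I_(k0 + T) <- enum 'I_(k0 + T) | A v && (v < k0 + k)%N].
have -> : (\sum_(v < k0 + T | A v) (v < k0 + k) = size s)%N.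
  rewrite size_map -sum1_size big_filter big_enum_cond/= big_mkcondr.
  by apply: eq_bigr => v _; case: (v < _)%N.
rewrite -[(size s).+1]/(size (start :: s)) -(size_iota 0 (k0 + k)).
apply: uniq_leq_size => [|v].
  rewrite cons_uniq (map_inj_uniq val_inj) (filter_uniq _ (enum_uniq _)) andbT.
  apply/mapP => -[v]; rewrite mem_filter => /andP[/andP[Av _] _] sv.
  by move: A_start; rewrite sv Av.
rewrite in_cons mem_iota add0n => /predU1P[->|/mapP[u]].
  by rewrite (leq_trans start0)// leq_addr.
by rewrite mem_filter => /andP[/andP[_ +] _] ->.
Qed.

(** The generators of [history n], needed apart from the sigma-algebra to build the type on which
    measurability is expressed. All gaps belong to it whatever [n], so the time of the next move is
    already known. *)
Definition history_gen (n : nat) : set_system Omega :=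
  [set B | (exists i, preimage_set_system setT (xi i) measurable B) \/
           (exists2 j, (j <= n)%N & preimage_set_system setT (pos j) measurable B)].

Lemma history_gen_measurable n : history_gen n `<=` measurable.
Proof.
by move=> B [[i]|[i _]] /preimage_set_systemP[C mC ->]; exact: measurable_funPTI.
Qed.

Lemma measurable_history_gap n i :
  measurable_fun (setT : set (g_sigma_algebraType (history_gen n))) (xi i).
Proof.
apply: measurable_fun_sub_gen => B mB; left; exists i.
by apply/preimage_set_systemP; exists B.
Qed.

Lemma measurable_history_pos n i : (i <= n)%N ->
  measurable_fun (setT : set (g_sigma_algebraType (history_gen n))) (pos i).
Proof.
move=> ni; apply: measurable_fun_sub_gen => B mB; right; exists i => //.
by apply/preimage_set_systemP; exists B.
Qed.

Lemma measurable_history_time n i :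
  measurable_fun (setT : set (g_sigma_algebraType (history_gen n))) (tau i).
Proof. by apply: measurable_sum => j; exact: measurable_history_gap. Qed.

Lemma measurable_jump_prob n v :
  measurable_fun (setT : set (g_sigma_algebraType (history_gen n)))
    (fun w => jump_prob k0 (tau n.+1 w) (pos n w) v : R).
Proof.
pose O := g_sigma_algebraType (history_gen n).
apply: (@measurable_fun_cases _ _ O R (pos n)
  (fun u w => jump_prob k0 (tau n.+1 w) u v)); first exact: measurable_history_pos.
move=> u; apply: (@measurable_fun_cases _ _ O R (fun w => Num.truncn (tau n.+1 w))
  (fun k _ => if (v < k0 + k)%N && (v != u) then (k0 + k).-1%:R^-1 else 0)) => //.
by apply: (measurableT_comp (@measurable_truncn R)); exact: measurable_history_time.
Qed.

(** Extends the jump rule from events to functions: on the sigma-algebra of the history, that rule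
    says that [P] restricted to the event of a jump to [v] has the jump probability as density with
    respect to [P]. *)
Lemma integral_jump n v (F : Omega -> R) :
  measurable_fun (setT : set (g_sigma_algebraType (history_gen n))) F ->
  (forall w, 0 <= F w) ->
  (\int[P]_w (F w * (pos n.+1 w == v)%:R)%:E =
   \int[P]_w (F w * jump_prob k0 (tau n.+1 w) (pos n w) v)%:E)%E.
Proof.
move=> mF F0; pose g w := jump_prob k0 (tau n.+1 w) (pos n w) v.
have g0 w : 0 <= g w by rewrite /g /jump_prob; case: ifP.
have mg : measurable_fun (setT : set (g_sigma_algebraType (history_gen n))) g.
  exact: measurable_jump_prob.
have Hm := @history_gen_measurable n.
have mid := measurable_id_sub Hm.
have mFO : measurable_fun setT F := measurable_fun_sub Hm mF.
have mE : measurable (pos n.+1 @^-1` [set v]) by exact: measurable_funPTI.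
pose PE : {measure set Omega -> \bar R} := mrestr P mE.
have [m1 [m1E m1i]] := pushforward_measureP P mid.
have [m2 [m2E m2i]] := pushforward_measureP PE mid.
have E1 (f : Omega -> R) : measurable_fun setT f -> (forall w, 0 <= f w) ->
    (\int[PE]_w (f w)%:E = \int[P]_w (f w * (pos n.+1 w == v)%:R)%:E)%E.
  move=> mf f0; apply: (@ge0_integral_density _ _ _ P PE (fun w => (pos n.+1 w == v)%:R)) => //.
  - by apply: (@measurable_fun_cases _ _ Omega R (pos n.+1) (fun u _ => (u == v)%:R)).
  - move=> B mB; rewrite /PE/= /mrestr.
    rewrite -[LHS]mul1e -integral_cst; last exact: measurableI.
    rewrite integral_mkcondr; apply: eq_integral => w _.
    rewrite patchE/=; have [pv|pv] := eqVneq (pos n.+1 w) v.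
      by rewrite mem_set.
    by rewrite memNset//; exact/eqP.
  - exact/measurable_EFinP.
rewrite -E1// -(m2i (EFin \o F))//; last exact/measurable_EFinP.
rewrite (ge0_integral_density (mu := m1) (p := g))//.
- rewrite -(m1i (fun w => (EFin \o F) w * (g w)%:E))%E//.
  + by apply: emeasurable_funM; exact/measurable_EFinP.
  + by move=> w; rewrite mule_ge0// lee_fin.
- move=> B mB; rewrite m2E/= /mrestr (walk_jump W); last exact: mB.
  rewrite [RHS]integral_mkcond [LHS]integral_mkcond [RHS]m1i; last 2 first.
  + apply/(measurable_restrictT _ _).1 => //.
    by apply/measurable_funTS/measurable_EFinP.
  + by move=> w; apply: erestrict_ge0 => u _; rewrite lee_fin.
  by [].
- exact/measurable_EFinP.
Qed.

(** When all gaps are nonnegative this is the indicator that none of the first [n] moves made by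
    time [T] lands in [A], written as a product so as to match [gap_weight] factor by factor. *)
Fixpoint avoid_weight (n : nat) (w : Omega) : R :=
  if n is n'.+1 then avoid_weight n' w *
    (if 0 <= xi n' w then
       (if tau n w <= T%:R then (~~ A (pos n w))%:R else 1) else 0)
  else 1.

Lemma avoid_weight01 n w : 0 <= avoid_weight n w <= 1.
Proof.
elim: n => [|n /andP[IH0 IH1]]/=; first by rewrite ler01 lexx.
set c := (if _ then _ else _).
have /andP[c0 c1] : 0 <= c <= 1.
  by rewrite /c; case: ifP => _; [case: ifP => _; [case: (A _)|]|]; rewrite ?lexx ?ler01.
by rewrite mulr_ge0//= mulr_ile1.
Qed.

Lemma avoid_weight_pos n w : avoid_weight n w != 0 -> tau n w <= T%:R -> ~~ A (pos n w).
Proof.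
case: n => [|n] /=; first by rewrite (walk_start W).
move=> + tT; rewrite tT; case: ifP => _; last by rewrite mulr0 eqxx.
by case: (A _) => //; rewrite mulr0 eqxx.
Qed.

Lemma measurable_avoid_weight m n : (n <= m)%N ->
  measurable_fun (setT : set (g_sigma_algebraType (history_gen m))) (avoid_weight n).
Proof.
elim: n => [|n IH] nm /=; first exact: measurable_cst.
apply: measurable_funM; first by apply: IH; exact: ltnW.
apply: measurable_fun_ifT => //=.
  by apply: measurable_fun_ler => //; exact: measurable_history_gap.
apply: measurable_fun_ifT => //=.
  by apply: measurable_fun_ler => //; exact: measurable_history_time.
apply: (@measurable_fun_cases _ _ (g_sigma_algebraType (history_gen m)) R (pos n.+1)
  (fun u _ => (~~ A u)%:R)) => //.
exact: measurable_history_pos.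
Qed.

Definition gap_factor (n : nat) (w : Omega) : R :=
  if 0 <= xi n w then 1 - hazard T hit_rate (tau n.+1 w) else 0.

Lemma gap_factor01 n w : 0 <= gap_factor n w <= 1.
Proof.
have /andP[h0 h1] := hazard01 T hit_rate01 (tau n.+1 w).
by rewrite /gap_factor; case: ifP => _; rewrite ?lexx ?ler01// subr_ge0 h1 gerBl.
Qed.

Lemma integrable_bounded01 (F : Omega -> R) : measurable_fun setT F ->
  (forall w, 0 <= F w <= 1) -> P.-integrable setT (EFin \o F).
Proof.
move=> mF F01; apply: measurable_bounded_integrable => //.
  by rewrite ltey_eq fin_num_measure.
exists 1; split => // M M1 w _ /=; have /andP[F0 F1] := F01 w.
by rewrite ger0_norm// (le_trans F1)// ltW.
Qed.

(* Given the past, a walker sitting outside [A] jumps into [A] at time [t] with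
   probability [hit_rate (truncn t)]. *)
Lemma avoid_weight_step n (F : Omega -> R) :
  (forall m, measurable_fun (setT : set (g_sigma_algebraType (history_gen m))) F) ->
  (forall w, 0 <= F w <= 1) ->
  (\int[P]_w (avoid_weight n.+1 w * F w)%:E =
   \int[P]_w (avoid_weight n w * (gap_factor n w * F w))%:E)%E.
Proof.
move=> mF F01.
pose E w := avoid_weight n w * (if 0 <= xi n w then F w else 0).
pose E' w := if tau n.+1 w <= T%:R then E w else 0.
have E01 w : 0 <= E w <= 1.
  have /andP[a0 a1] := avoid_weight01 n w; have /andP[F0 F1] := F01 w.
  by rewrite /E; case: ifP => _; rewrite ?mulr0 ?lexx ?ler01// mulr_ge0// mulr_ile1.
have E'01 w : 0 <= E' w <= 1 by rewrite /E'; case: ifP => _; rewrite ?lexx ?ler01.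
have mE : measurable_fun (setT : set (g_sigma_algebraType (history_gen n))) E.
  apply: measurable_funM; first exact: measurable_avoid_weight.
  apply: measurable_fun_ifT => //=.
  by apply: measurable_fun_ler => //; exact: measurable_history_gap.
have mE' : measurable_fun (setT : set (g_sigma_algebraType (history_gen n))) E'.
  apply: measurable_fun_ifT => //=.
  by apply: measurable_fun_ler => //; exact: measurable_history_time.
have sub (f : Omega -> R) : measurable_fun (setT : set (g_sigma_algebraType (history_gen n))) f ->
  measurable_fun (setT : set Omega) f.
  by apply: measurable_fun_sub; exact: history_gen_measurable.
have mA : measurable_fun setT (fun w => (A (pos n.+1 w))%:R : R).
  by apply: (@measurable_fun_cases _ _ Omega R (pos n.+1) (fun u _ => (A u)%:R)).
have mh : measurable_fun setT (fun w => hazard T hit_rate (tau n.+1 w)).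
  apply: (measurableT_comp (measurable_hazard T hit_rate)).
  by apply: sub; exact: measurable_history_time.
pose L w := E' w * (A (pos n.+1 w))%:R.
pose Rr w := E w * hazard T hit_rate (tau n.+1 w).
have L01 w : 0 <= L w <= 1.
  have /andP[a0 a1] := E'01 w.
  by rewrite /L; case: (A _); rewrite ?mulr1 ?mulr0 ?lexx ?ler01 ?a0.
have R01 w : 0 <= Rr w <= 1.
  have /andP[a0 a1] := E01 w; have /andP[h0 h1] := hazard01 T hit_rate01 (tau n.+1 w).
  by rewrite mulr_ge0// mulr_ile1.
pose s := [seq v : 'I_(k0 + T) <- index_enum 'I_(k0 + T) | A v].
have LR : (\int[P]_w (L w)%:E = \int[P]_w (Rr w)%:E)%E.
  transitivity (\int[P]_w \sum_(v <- s) (E' w * (pos n.+1 w == v)%:R)%:E)%E.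
    apply: eq_integral => w _; rewrite sumEFin; congr EFin.
    rewrite big_filter -mulr_sumr /L; congr (_ * _).
    have [Ap|Ap] := boolP (A (pos n.+1 w)); last first.
      by rewrite big1// => v Av; case: eqP => // pv; move: Ap; rewrite pv Av.
    rewrite (bigD1 (Ordinal (A_lt Ap)))//= eqxx big1 ?addr0// => v /andP[_].
    by rewrite -val_eqE/= eq_sym => /negbTE ->.
  rewrite ge0_integral_sum//; last 2 first.
  - move=> v; apply/measurable_EFinP; apply: measurable_funM; first exact: sub.
    by apply: (@measurable_fun_cases _ _ Omega R (pos n.+1) (fun u _ => (u == v)%:R)).
  - by move=> v w _; rewrite lee_fin mulr_ge0//; have /andP[] := E'01 w.
  transitivity (\sum_(v <- s)
      \int[P]_w (E' w * jump_prob k0 (tau n.+1 w) (pos n w) v)%:E)%E.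
    by apply: eq_bigr => v _; apply: integral_jump => // w; have /andP[] := E'01 w.
  rewrite -ge0_integral_sum//; last 2 first.
  - move=> v; apply/measurable_EFinP; apply: measurable_funM; first exact: sub.
    by apply: sub; exact: measurable_jump_prob.
  - move=> v w _; rewrite lee_fin mulr_ge0//; first by have /andP[] := E'01 w.
    by rewrite /jump_prob; case: ifP.
  apply: eq_integral => w _; rewrite sumEFin; congr EFin.
  rewrite big_filter -mulr_sumr /Rr /E' /hazard; case: ifP => tT; last by rewrite mul0r mulr0.
  (* Where the weight is nonzero the previous move time is also at most [T] and the walker sits
     outside [A]. Hence [v != pos n w] holds for every [v] in [A], and the position drops out of the
     jump probability. *)
  have [E0|En0] := eqVneq (E w) 0; first by rewrite E0 !mul0r.
  congr (_ * _); rewrite /hit_rate mulr_suml; apply: eq_bigr => v Av.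
  have : E w != 0 by [].
  rewrite /E mulf_eq0 negb_or => /andP[an0]; case: ifP => [xi0 _|_]; last by rewrite eqxx.
  have tn : tau n w <= T%:R.
    by apply: le_trans tT; rewrite /move_time big_ord_recr/= lerDl.
  have pA := avoid_weight_pos an0 tn.
  rewrite /jump_prob /nb_present.
  have -> : (v != pos n w :> nat) by apply: contraNneq pA => <-.
  by rewrite andbT; case: ifP => _; rewrite ?mul1r ?mul0r.
transitivity (\int[P]_w ((E w)%:E - (L w)%:E))%E.
  apply: eq_integral => w _; rewrite -EFinB; congr EFin => /=.
  rewrite /L /E' /E; case: ifP => _; last first.
    by rewrite !mulr0 mul0r; case: ifP => _; rewrite ?mul0r subr0.
  case: ifP => _; last by rewrite mul0r subr0 mulr1.
  by case: (A _); rewrite ?mulr0 ?mulr1 ?mul0r ?subrr ?subr0.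
transitivity (\int[P]_w ((E w)%:E - (Rr w)%:E))%E; last first.
  apply: eq_integral => w _; rewrite -EFinB; congr EFin.
  by rewrite /Rr /E /gap_factor; case: ifP => _; ring.
have iE : P.-integrable setT (EFin \o E) by apply: integrable_bounded01 => //; exact: sub.
rewrite !integralB_EFin//=.
- by rewrite LR.
- by apply: integrable_bounded01 => //; apply: measurable_funM => //; exact: sub.
- by apply: integrable_bounded01 => //; apply: measurable_funM => //; exact: sub.
Qed.

(** The moves are peeled off from the last one. Each yields a factor depending on the gaps alone,
    which can be absorbed into [F]; this is why [F] is required to be measurable for every
    history. *)
Lemma integral_avoid_weight n (F : Omega -> R) :
  (forall m, measurable_fun (setT : set (g_sigma_algebraType (history_gen m))) F) ->
  (forall w, 0 <= F w <= 1) ->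
  (\int[P]_w (avoid_weight n w * F w)%:E =
   \int[P]_w (gap_weight T hit_rate (gap w) n * F w)%:E)%E.
Proof.
elim: n F => [//|n IH] F mF F01.
rewrite avoid_weight_step// IH.
- by apply: eq_integral => w _ /=; rewrite mulrA.
- move=> m; apply: measurable_funM => //; apply: measurable_fun_ifT => //=.
    by apply: measurable_fun_ler => //; exact: measurable_history_gap.
  apply: measurable_funB => //; apply: (measurableT_comp (measurable_hazard T hit_rate)).
  exact: measurable_history_time.
- move=> w; have /andP[F0 F1] := F01 w; have /andP[c0 c1] := gap_factor01 n w.
  by rewrite mulr_ge0// mulr_ile1.
Qed.

Definition avoids (n : nat) : set Omega :=
  [set w | forall j, (j <= n)%N -> tau j w <= T%:R -> ~~ A (pos j w)].

Lemma gap_ge0_ae : {ae P, forall w, forall i, 0 <= xi i w}.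
Proof.
apply/ae_foralln => i; exists (xi i @^-1` `]-oo, 0[); split.
- exact: measurable_funPTI.
- rewrite -[LHS]/(distribution P (xi i) `]-oo, 0[%classic) (walk_exponential W)//.
  rewrite /exponential_prob; apply: integral0_eq => x /=; rewrite in_itv/= => x0.
  by rewrite lt0_exponential_pdf.
- by move=> w /=; rewrite in_itv/= => /negP; rewrite -ltNge.
Qed.

Lemma avoid_weightE n w : (forall i, 0 <= xi i w) -> avoid_weight n w = \1_(avoids n) w.
Proof.
move=> xi0; elim: n => [|n IH] /=.
  rewrite indicE mem_set// => j; rewrite leqn0 => /eqP -> _.
  by rewrite (walk_start W).
rewrite IH xi0 !indicE.
have [na|na] := pselect (avoids n w); last first.
  rewrite memNset// memNset ?mul0r// => h; apply: na => j jn.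
  by apply: h; exact: leqW.
rewrite mem_set// mul1r; case: ifPn => tT.
  have [An|An] := boolP (A (pos n.+1 w)).
    by rewrite memNset//= => /(_ n.+1 (leqnn _) tT); rewrite An.
  rewrite mem_set//= => j; rewrite leq_eqVlt => /predU1P[->//|]; exact: na.
rewrite mem_set//= => j; rewrite leq_eqVlt => /predU1P[->|]; last exact: na.
by rewrite (negbTE tT).
Qed.

Lemma measurable_avoids n : measurable (avoids n).
Proof.
rewrite (_ : avoids n = \bigcap_(j in [set j | (j <= n)%N])
    ([set w | T%:R < tau j w] `|` [set w | ~~ A (pos j w)])); last first.
  apply/seteqP; split => w h j jn.
    by have [tT|tT] := leP (tau j w) T%:R; [right; exact: h|left].
  by have [/=|//] := h j jn; rewrite ltNge => /negbTE ->.
apply: bigcap_measurable => [|j _]; first by exists 0%N.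
apply: measurableU.
  rewrite [X in measurable X](_ : _ = tau j @^-1` `]T%:R, +oo[); last first.
    by apply/seteqP; split => w; rewrite /= in_itv/= andbT.
  rewrite -[X in measurable X]setTI.
  by apply: measurable_sum => // i; exact: measurable_funP.
rewrite [X in measurable X](_ : _ = pos j @^-1` [set u | ~~ A u]); last by [].
exact: measurable_funPTI.
Qed.

(** The event is the decreasing intersection of the [avoids n]. Their probabilities are the means of
    [avoid_weight n], hence of [gap_weight n], whose limit is [survival] at time 0. *)
Lemma probability_avoids :
  P [set w | forall v, A v -> ~ visited xi pos T w v] =
  (expR (- lambda * \sum_(j < T) hit_rate j))%:E.
Proof.
have -> : [set w | forall v, A v -> ~ visited xi pos T w v] = \bigcap_n avoids n.
  apply/seteqP; split => w h.
    move=> n _ j jn tT; apply/negP => Aj; apply: (h _ Aj).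
    by exists j.
  move=> v Av [n [tT pv]]; have := h n I n (leqnn _) tT.
  by rewrite pv Av.
have c1 : (P \o avoids) n @[n --> \oo] --> P (\bigcap_n avoids n).
  apply: nonincreasing_cvg_mu => //.
  - by rewrite ltey_eq fin_num_measure//; exact: measurable_avoids.
  - exact: measurable_avoids.
  - by apply: bigcapT_measurable; exact: measurable_avoids.
  - move=> m n mn; apply/subsetPset => w h j jm; apply: h; exact: leq_trans mn.
have c2 : (P \o avoids) n @[n --> \oo] --> (survival lambda T hit_rate 0)%:E.
  have -> : (P \o avoids) = (fun n => \int[P]_w (gap_weight T hit_rate (gap w) n)%:E)%E; last first.
    by have := @gap_weight_cvg _ _ _ P xi lambda lambda0 (walk_exponential W)
      (walk_independent W) T hit_rate hit_rate01.
  apply/funext => n /=; apply/esym.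
  transitivity (\int[P]_w (avoid_weight n w * 1)%:E)%E.
    rewrite integral_avoid_weight//; last by move=> w; rewrite ler01 lexx.
    by apply: eq_integral => w _; rewrite mulr1.
  rewrite -[avoids n]setIT -integral_indic//; last exact: measurable_avoids.
  apply: ae_eq_integral => //.
  - apply/measurable_EFinP; apply: measurable_funM => //.
    apply: (@measurable_fun_sub _ _ _ (@history_gen_measurable n)).
    exact: measurable_avoid_weight.
  - by apply/measurable_EFinP; apply: measurable_indic; exact: measurable_avoids.
  - by apply: filterS gap_ge0_ae => w /avoid_weightE h _; rewrite mulr1 h.
rewrite -(big_mkord xpredT hit_rate) -(survival_nat lambda T hit_rate 0).
exact: cvg_unique c1 c2.
Qed.

End walk.

(** * Recovering a law from its sums over supersets *)

Section poisson_binomial_law.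
Variables (R : realType) (I : finType) (p : I -> R).
Implicit Types (X S : {set I}).

Lemma bern_mean_superset S :
  bern_mean p (fun X => (S \subset X)%:R) = \prod_(v in S) p v.
Proof.
rewrite big_mkcond/=.
rewrite (eq_bigr (fun v => p v + (if v \in S then 0 else 1 - p v))); last first.
  by move=> v _; case: ifP => _; rewrite ?addr0 ?subrKC.
rewrite bigA_distr; apply: eq_bigr => X _; rewrite /bern_weight.
have [SX|/subsetPn[v vS vX]] := boolP (S \subset X).
  rewrite mulr1; apply: eq_bigr => v _; case: ifPn => // vX.
  by have /negbTE -> : v \notin S by apply: contra vX => /(fintype.subsetP SX).
by rewrite mulr0 (bigD1 v)//= (negbTE vX) vS mul0r.
Qed.

(** Möbius inversion on the subset lattice, as an induction on the size of the complement: the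
    values on strictly larger sets are known to agree and cancel. *)
Lemma superset_sums_inj (q r : {set I} -> R) :
  (forall S, \sum_(X : {set I} | S \subset X) q X =
    \sum_(X : {set I} | S \subset X) r X) -> q =1 r.
Proof.
move=> qr; move=> X; have [m] := ubnP #|finset.setC X|; elim: m X => // m IH X Xm.
have := qr X; rewrite (bigD1 X)//= [RHS](bigD1 X)//=.
rewrite [X in _ + X = _](eq_bigr r); first by move/addIr.
move=> Y /andP[XY YX]; apply: IH; rewrite -ltnS (leq_trans _ Xm)// ltnS.
apply: proper_card; rewrite properE finset.setCS XY/=.
by apply: contra YX; rewrite finset.setCS finset.eqEsubset XY andbT.
Qed.

End poisson_binomial_law.

Section unvisited.
Context d (Omega : measurableType d) (R : realType) (P : probability Omega R).
Variables (k0 : nat) (lambda : R) (start : nat).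
Variables (xi : nat -> {RV P >-> R}) (pos : nat -> {RV P >-> nat}).
Hypothesis hk0 : (3 <= k0)%N.
Hypothesis lambda0 : 0 < lambda.
Hypothesis W : growing_walk k0 lambda start xi pos.
Variable T : nat.

Definition exposure (v : nat) : R := \sum_(j < T) (v < k0 + j)%:R / (k0 + j).-1%:R.

(** The starting vertex, visited at time 0, is kept as a degenerate variable of parameter 0, so that
    the product law covers all vertices. *)
Definition unvisited_prob (v : 'I_(k0 + T)) : R :=
  if v == start :> nat then 0 else expR (- lambda * exposure v).

Lemma unvisited_prob01 v : 0 <= unvisited_prob v <= 1.
Proof.
rewrite /unvisited_prob; case: ifP => _; first by rewrite lexx ler01.
rewrite expR_ge0/= expR_le1 mulNr oppr_le0 mulr_ge0 ?(ltW lambda0)//.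
by apply: sumr_ge0 => j _; rewrite divr_ge0.
Qed.

Definition unvisited (w : Omega) : {set 'I_(k0 + T)} :=
  [set v : 'I_(k0 + T) | ~~ `[< visited xi pos T w v >]].

Lemma unvisitedP w (v : 'I_(k0 + T)) : reflect (~ visited xi pos T w v) (v \in unvisited w).
Proof. by rewrite inE; apply: (iffP negP) => h /asboolP; exact: h. Qed.

Lemma measurable_visited v : measurable [set w | visited xi pos T w v].
Proof.
rewrite (_ : [set _ | _] =
  \bigcup_n ((move_time xi n @^-1` `]-oo, T%:R]) `&` (pos n @^-1` [set v]))); last first.
  by apply/seteqP; split => w [n]; [move=> h; exists n => //|move=> _ h; exists n];
    move: h; rewrite /= in_itv/=.
apply: bigcupT_measurable => n; apply: measurableI; last exact: measurable_funPTI.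
rewrite -[X in measurable X]setTI.
by apply: measurable_sum => // i; exact: measurable_funP.
Qed.

Lemma measurable_unvisited X : measurable [set w | unvisited w = X].
Proof.
rewrite (_ : [set _ | _] = \bigcap_(v in [set: 'I_(k0 + T)])
   (if v \in X then ~` [set w | visited xi pos T w v] else [set w | visited xi pos T w v])).
  apply: fin_bigcap_measurable => // v _; case: ifP => _.
    by apply: measurableC; exact: measurable_visited.
  exact: measurable_visited.
apply/seteqP; split => w.
  move=> /= <- v _; case: ifPn => [/unvisitedP//|/unvisitedP].
  by move/contrapT.
move=> /= h; apply/finset.setP => v; have := h v I.
by case: ifPn => vX hv; apply/unvisitedP.
Qed.

Lemma probability_unvisited_superset (S : {set 'I_(k0 + T)}) :
  P [set w | S \subset unvisited w] = (\prod_(v in S) unvisited_prob v)%:E.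
Proof.
have [/existsP[u /andP[uS us]]|nS] := boolP [exists u, (u \in S) && (u == start :> nat)].
  rewrite (bigD1 u)//= /unvisited_prob us mul0r.
  rewrite (_ : [set _ | _] = set0) ?measure0//.
  apply/seteqP; split => // w /= /fintype.subsetP/(_ u uS)/unvisitedP; apply.
  exists 0%N; rewrite /move_time big_ord0 ler0n; split => //.
  by rewrite (walk_start W); exact/esym/eqP.
have sS u : u \in S -> u != start :> nat.
  by move=> uS; apply: contra nS => us; apply/existsP; exists u; rewrite uS.
pose A : pred nat := fun v => [exists u, (u \in S) && (u == v :> nat)].
have AE (u : 'I_(k0 + T)) : A u = (u \in S).
  apply/existsP/idP => [[u' /andP[u'S /eqP/val_inj <-]]//|uS].
  by exists u; rewrite uS eqxx.
have A_lt v : A v -> (v < k0 + T)%N.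
  by move=> /existsP[u /andP[_ /eqP <-]]; exact: ltn_ord.
have := probability_avoids hk0 lambda0 W nS A_lt.
rewrite (_ : [set w | forall v, _] = [set w | S \subset unvisited w]); last first.
  apply/seteqP; split => w /=.
    by move=> h; apply/fintype.subsetP => u uS; apply/unvisitedP/h; rewrite AE.
  by move=> /fintype.subsetP h v /existsP[u /andP[uS /eqP <-]]; apply/unvisitedP/h.
move=> ->; congr EFin.
rewrite (eq_bigr (fun v : 'I_(k0 + T) => expR (- lambda * exposure v))); last first.
  by move=> v /sS; rewrite /unvisited_prob => /negbTE ->.
rewrite -expR_sum; congr expR; rewrite -mulr_sumr; congr (_ * _).
rewrite exchange_big/=; apply: eq_bigr => j _.
rewrite /hit_rate mulr_suml; apply: eq_bigl => v; exact: AE.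
Qed.

Lemma expectation_unvisited_sum (G : {set 'I_(k0 + T)} -> R) :
  ('E_P[G \o unvisited] = \sum_X (G X)%:E * P [set w | unvisited w = X])%E.
Proof.
rewrite unlock.
transitivity (\int[P]_w \sum_X ((G X)%:E * (\1_[set w | unvisited w = X] w)%:E))%E.
  apply: eq_integral => w _ /=; rewrite (bigD1 (unvisited w))//= indicE mem_set// mule1.
  rewrite big1 ?adde0// => X /eqP wX; rewrite indicE memNset ?mule0//=.
  exact/nesym.
have iX X : P.-integrable setT (fun w => (\1_[set w | unvisited w = X] w)%:E).
  by apply: integrable_indic => //; exact: measurable_unvisited.
rewrite integral_sum//; last by move=> X; exact: integrableZl.
apply: eq_bigr => X _; rewrite integralZl// integral_indic ?setIT//.
exact: measurable_unvisited.
Qed.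

Lemma probability_unvisited X :
  P [set w | unvisited w = X] = (bern_weight unvisited_prob X)%:E.
Proof.
pose q Y := fine (P [set w | unvisited w = Y]).
have qE Y : P [set w | unvisited w = Y] = (q Y)%:E.
  by rewrite /q fineK// fin_num_measure//; exact: measurable_unvisited.
rewrite qE; congr EFin; apply: superset_sums_inj => S.
transitivity (bern_mean unvisited_prob (fun X => (S \subset X)%:R)); last first.
  rewrite [RHS]big_mkcond; apply: eq_bigr => Y _.
  by case: ifP; rewrite ?mulr1 ?mulr0.
rewrite bern_mean_superset; apply: EFin_inj; rewrite -probability_unvisited_superset.
have mS : measurable [set w | S \subset unvisited w].
  rewrite (_ : [set _ | _] = \bigcup_(X in [set X : {set 'I_(k0 + T)} | S \subset X])
    [set w | unvisited w = X]).
    by apply: fin_bigcup_measurable => // Y _; exact: measurable_unvisited.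
  by apply/seteqP; split => [w Sw|w [Y SY] /= wY]; [exists (unvisited w)|rewrite wY].
rewrite -[RHS]expectation_indic//.
transitivity ('E_P[(fun X => (S \subset X)%:R) \o unvisited])%E; last first.
  congr ('E_P[_])%E; apply/funext => w; rewrite indicE/=; congr ((_ : bool)%:R).
  by apply/idP/idP => [h|/set_mem//]; exact/mem_set.
rewrite (expectation_unvisited_sum (fun X => (S \subset X)%:R)) -sumEFin [LHS]big_mkcond.
apply: eq_bigr => Y _.
by rewrite qE; case: ifP; rewrite ?mul1e ?mul0e.
Qed.

Lemma expectation_unvisited (G : {set 'I_(k0 + T)} -> R) :
  ('E_P[G \o unvisited] = (bern_mean unvisited_prob G)%:E)%E.
Proof.
rewrite expectation_unvisited_sum /bern_mean -sumEFin; apply: eq_bigr => X _.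
by rewrite probability_unvisited -EFinM mulrC.
Qed.

Lemma normalized_visitedE :
  normalized_visited k0 xi pos T = bern_normalized unvisited_prob \o unvisited.
Proof.
have NE w : (nb_visited k0 xi pos T w)%:R = (k0 + T)%:R - #|unvisited w|%:R :> R.
  apply/eqP; rewrite eq_sym subr_eq -natrD eqr_nat -[X in X == _]card_ord.
  rewrite -(cardC [pred v : 'I_(k0 + T) | `[< visited xi pos T w v >]]) eqn_add2l.
  by apply/eqP/eq_card => v; rewrite !inE.
have EN : ('E_P[fun w => (nb_visited k0 xi pos T w)%:R] =
    ((k0 + T)%:R - bern_expect unvisited_prob)%:E)%E.
  rewrite (_ : (fun w => _) =
    (fun X : {set 'I_(k0 + T)} => (k0 + T)%:R - #|X|%:R) \o unvisited); last exact/funext/NE.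
  by rewrite expectation_unvisited bern_meanB bern_mean_cst bern_mean_card.
have VN : ('V_P[fun w => (nb_visited k0 xi pos T w)%:R] = (bern_var unvisited_prob)%:E)%E.
  rewrite /variance covariance.unlock EN [X in ('E_P[X])%E](_ : _ =
    (fun X : {set 'I_(k0 + T)} => (#|X|%:R - bern_expect unvisited_prob) ^+ 2) \o unvisited).
    by rewrite expectation_unvisited bern_mean_var.
  by apply/funext => w; rewrite /GRing.mul/= NE; ring.
apply/funext => w; rewrite /normalized_visited EN VN /= NE /bern_normalized.
by congr (_ / _); ring.
Qed.

End unvisited.

(** * The variance *)

Lemma sum_leq_ord (m n : nat) : (\sum_(j < n) (m <= j) = n - m)%N.
Proof.
by elim: n => [|n IH]; rewrite ?big_ord0// big_ord_recr/= IH; lia.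
Qed.

Section variance.
Variables (R : realType) (k0 : nat) (lambda : R).
Hypothesis hk0 : (3 <= k0)%N.
Hypothesis lambda0 : 0 < lambda.
Variables (T : nat).
Hypothesis T0 : (0 < T)%N.

Let a := (T %/ 4)%N.

Let Ta : (T <= 4 * a + 3)%N.
Proof. by rewrite /a; lia. Qed.

Let aT : (4 * a <= T)%N.
Proof. by rewrite /a; lia. Qed.

(** Such a vertex is present only for [j >= a - 1], and then [k0 >= 3] makes each term at most
    [1 / (a + 1)]. There are at most [T - a.-1] terms, and [T <= 4 a + 3] bounds their number by
    [4 (a + 1)]. *)
Lemma exposure_ub v : (k0 - 2 + a <= v)%N -> exposure R k0 T v <= 4.
Proof.
move=> kv; have a1 : 0 < (a.+1%:R : R) by rewrite ltr0n.
have step (j : 'I_T) : (v < k0 + j)%:R / (k0 + j).-1%:R <= (a <= j.+1)%:R / a.+1%:R :> R.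
  case: ltnP => [vj|_]; last by rewrite mul0r divr_ge0.
  have aj : (a <= j.+1)%N by lia.
  rewrite aj !mul1r lef_pV2 ?posrE ?ltr0n ?ler_nat//; lia.
apply: (le_trans (ler_sum _ (fun j _ => step j))).
rewrite -mulr_suml ler_pdivrMr// -natr_sum.
have -> : (\sum_(j < T) (a <= j.+1) = T - a.-1)%N.
  by rewrite -sum_leq_ord; apply: eq_bigr => j _; congr nat_of_bool; lia.
rewrite -natrM ler_nat; lia.
Qed.

(** Such a vertex is present for all [j >= 2 a], which gives at least [T / 2] terms, each at least
    [1 / (k0 + T)]; and [T / (k0 + T) >= 1 / (k0 + 1)]. *)
Lemma exposure_lb v : (v < k0 + 2 * a)%N -> (2 * k0.+1)%:R^-1 <= exposure R k0 T v.
Proof.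
move=> vk.
have step (j : 'I_T) : (2 * a <= j)%:R / (k0 + T)%:R <= (v < k0 + j)%:R / (k0 + j).-1%:R :> R.
  case: (leqP (2 * a) j) => [aj|_]; last by rewrite mul0r divr_ge0.
  have -> : (v < k0 + j)%N by lia.
  rewrite !mul1r lef_pV2 ?posrE ?ltr0n ?ler_nat; have := ltn_ord j; lia.
apply: le_trans (ler_sum _ (fun j _ => step j)).
rewrite -mulr_suml -natr_sum.
rewrite sum_leq_ord.
rewrite ler_pdivlMr ?ltr0n; last by lia.
rewrite mulrC ler_pdivrMr ?ltr0n; last by lia.
rewrite -natrM ler_nat; nia.
Qed.

Definition var_const : R :=
  expR (- lambda * 4) * (1 - expR (- lambda * (2 * k0.+1)%:R^-1)).

Lemma var_const_gt0 : 0 < var_const.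
Proof.
by rewrite mulr_gt0 ?expR_gt0// subr_gt0 expR_lt1 mulNr oppr_lt0 mulr_gt0//.
Qed.

(* Only the [a + 2] vertices numbered from [k0 - 2 + a] on are used, at most one of
   which is [start]; their exposure lies between two positive constants. *)
Lemma bern_var_lb start :
  var_const / 4 * T%:R <= bern_var (@unvisited_prob R k0 lambda start T).
Proof.
set p := @unvisited_prob R k0 lambda start T; have c0 := ltW var_const_gt0.
(* Starting two places below [k0 + a] leaves a vertex other than [start] even when [T < 4], where
   [a = 0]. *)
have lt i : (i < a.+2)%N -> (k0 - 2 + a + i < k0 + T)%N by lia.
pose f (i : 'I_a.+2) := Ordinal (lt i (ltn_ord i)).
have finj : injective f.
  by move=> i j /(congr1 val) /= /eqP; rewrite eqn_add2l => /eqP /val_inj.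
have pq (v : 'I_(k0 + T)) : 0 <= p v * (1 - p v).
  by have /andP[p0 p1] := unvisited_prob01 start lambda0 v; rewrite mulr_ge0// subr_ge0.
apply: (@le_trans _ _ (\sum_(i < a.+2) p (f i) * (1 - p (f i)))); last first.
  rewrite -(big_imset (h := f) (fun v => p v * (1 - p v)) (A := predT)); last first.
    by move=> i j _ _ /finj.
  rewrite /bern_var [leRHS](bigID (mem (f @: predT)))/= lerDl.
  by apply: sumr_ge0 => v _.
apply: (@le_trans _ _ (\sum_(i < a.+2) var_const * (1 - (f i == start :> nat)%:R))).
  rewrite -mulr_sumr sumrB sumr_const card_ord -natr_sum.
  have : (\sum_(i < a.+2) (f i == start :> nat) <= 1)%N.
    rewrite (eq_bigr (fun i : 'I_a.+2 => if f i == start :> nat then 1%N else 0%N)); last first.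
      by move=> i _; case: eqP.
    rewrite -big_mkcond sum1_card; apply/card_le1_eqP => i j.
    rewrite !unfold_in => /eqP fi /eqP fj; apply: finj; apply: val_inj.
    by rewrite /= in fi fj *; lia.
  rewrite -(ler_nat R) => s1; rewrite mulrAC -mulrA ler_wpM2l// ler_pdivrMr//.
  (* Discarding [start] leaves at least [a + 1 >= T / 4] vertices: this is the 4 dividing
     [var_const]. *)
  have : T%:R <= (4 * a + 3)%:R :> R by rewrite ler_nat.
  by rewrite natrD natrM -!natr1; lra.
apply: ler_sum => i _; have [fs|fs] := eqVneq (f i : nat) start.
  by rewrite subrr mulr0.
rewrite subr0 mulr1 /p /unvisited_prob (negbTE fs) /var_const.
have e4 : exposure R k0 T (f i) <= 4 by apply: exposure_ub => /=; lia.
have e1 : (2 * k0.+1)%:R^-1 <= exposure R k0 T (f i).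
  by apply: exposure_lb => /=; have := ltn_ord i; lia.
apply: ler_pM; rewrite ?expR_ge0//.
- by rewrite subr_ge0 expR_le1 mulNr oppr_le0 mulr_ge0 ?ltW// invr_gt0 ltr0n.
- by rewrite ler_expR !mulNr lerN2 ler_pM2l.
- by rewrite lerB// ler_expR !mulNr lerN2 ler_pM2l.
Qed.

End variance.

(** * Convergence in distribution *)

Section gaussian_expectation.
Context d (Omega : measurableType d) (R : realType) (Q : probability Omega R).
Variable G : {RV Q >-> R}.
Hypothesis G_gauss : standard_gaussian G.

Lemma expectation_standard_gaussian (f : R -> R) : measurable_fun setT f ->
  ('E_Q[f \o G] = \int[@normal_prob R 0 1]_x (f x)%:E)%E.
Proof.
move=> mf; rewrite unlock.
have mG : measurable_fun setT (fun w => (G w : measurableTypeR R)).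
  by move=> _ A mA; exact: (@measurable_funP _ _ _ _ setT G measurableT A mA).
have [nu [nuE nui]] := pushforward_measureP Q mG.
have E (g : R -> \bar R) : measurable_fun setT g -> (forall x, 0 <= g x)%E ->
    (\int[Q]_w g (G w) = \int[@normal_prob R 0 1]_x g x)%E.
  move=> mg g0; rewrite -(nui g mg g0); apply: eq_measure_integral => A mA _.
  by rewrite nuE; exact: G_gauss.
have mfE : measurable_fun setT (EFin \o f) by exact/measurable_EFinP.
rewrite [LHS]integralE [RHS]integralE; congr (_ - _)%E.
- rewrite -E//; first by apply: eq_integral => w _; rewrite !funeposE.
  exact: measurable_funepos.
- rewrite -E//; first by apply: eq_integral => w _; rewrite !funenegE.
  exact: measurable_funeneg.
Qed.

End gaussian_expectation.

Section inf_convolution.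
Variable R : realType.
Variables (f : R -> R) (M : R).
Hypothesis fM : forall x, `|f x| <= M.
Implicit Types (x y k : R).

(* The largest k-Lipschitz minorant of [f]. *)
Definition inf_conv k x : R := inf [set f y + k * `|x - y| | y in setT].

Let inf_conv_lb k x : 0 <= k -> lbound [set f y + k * `|x - y| | y in setT] (- M).
Proof.
move=> k0 _ [y _ <-]; have := fM y; rewrite ler_norml => /andP[My _].
by rewrite (le_trans My)// lerDl mulr_ge0.
Qed.

Lemma inf_conv_le k x y : 0 <= k -> inf_conv k x <= f y + k * `|x - y|.
Proof.
move=> k0; apply: ge_inf; last by exists y.
by exists (- M); exact: inf_conv_lb.
Qed.

Lemma le_inf_conv k x (b : R) : (forall y, b <= f y + k * `|x - y|) -> b <= inf_conv k x.
Proof.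
move=> h; apply: lb_le_inf; first by exists (f x + k * `|x - x|), x.
by move=> _ [y _ <-].
Qed.

Lemma inf_conv_bounded k x : 0 <= k -> `|inf_conv k x| <= M.
Proof.
move=> k0; rewrite ler_norml; apply/andP; split.
  apply: le_inf_conv => y; have h := @inf_conv_lb k x k0.
  by apply: h; exists y.
apply: le_trans (inf_conv_le x x k0) _; rewrite subrr normr0 mulr0 addr0.
by apply: le_trans (fM x); exact: ler_norm.
Qed.

Lemma inf_conv_lipschitz k x y : 0 <= k ->
  `|inf_conv k x - inf_conv k y| <= k * `|x - y|.
Proof.
move=> k0.
have half u v : inf_conv k u - k * `|u - v| <= inf_conv k v.
  apply: le_inf_conv => z; rewrite lerBlDr (le_trans (inf_conv_le u z k0))//.
  by rewrite -addrA lerD2l -mulrDr ler_wpM2l// [leRHS]addrC ler_distD.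
have h1 := half x y; have h2 := half y x; rewrite distrC in h2.
by rewrite ler_norml; apply/andP; split; lra.
Qed.

(** Points [y] within [r] of [x] have [f y] close to [f x]; for the others the penalty exceeds the
    oscillation [2 M] once [n >= 2 M / r]. *)
Lemma inf_conv_cvg x : {for x, continuous f} -> inf_conv n.+1%:R x @[n --> \oo] --> f x.
Proof.
move=> /cvgrPdist_le cf; apply/cvgrPdist_le => e e0.
have /nbhs_ballP[r /= r0 rf] := cf e e0.
near=> n.
have n0 : 0 <= n.+1%:R :> R by [].
have up := inf_conv_le x x n0; rewrite subrr normr0 mulr0 addr0 in up.
rewrite ger0_norm ?subr_ge0// lerBlDr -lerBlDl.
apply: le_inf_conv => y.
have [xy|xy] := ltP `|x - y| r.
  have := rf y xy => /=; rewrite ler_norml => /andP[_ h].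
  by have h2 : 0 <= n.+1%:R * `|x - y|; [rewrite mulr_ge0|lra].
have := fM x; have := fM y; rewrite !ler_norml => /andP[fy _] /andP[_ fx].
suff : 2 * M <= n.+1%:R * `|x - y| by lra.
apply: le_trans (ler_wpM2l n0 xy); rewrite -ler_pdivrMr//.
apply: (@le_trans _ _ n%:R); last by rewrite ler_nat.
near: n; exact: nbhs_infty_ger.
Unshelve. all: by end_near. Qed.

End inf_convolution.

Section lipschitz_test_functions.
Variable R : realType.
Notation N01 := (@normal_prob R 0 1).
Implicit Types (f g h : R -> R) (x y k : R).
Variable mean : nat -> (R -> R) -> R.
Hypothesis mean_le : forall n f g, (forall x, f x <= g x) -> mean n f <= mean n g.
Hypothesis meanZ : forall n k f, mean n (fun x => k * f x) = k * mean n f.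
Hypothesis mean_lipschitz : forall h : R -> R,
  (forall x y, `|h x - h y| <= `|x - y|) ->
  mean n h @[n --> \oo] --> fine (\int[N01]_x (h x)%:E).

Let integrable_bounded f (M : R) : measurable_fun setT f -> (forall x, `|f x| <= M) ->
  N01.-integrable setT (EFin \o f).
Proof.
move=> mf fM; apply: measurable_bounded_integrable => //.
  by rewrite ltey_eq fin_num_measure.
by exists M; split; [exact: num_real|move=> N MN x _ /=]; rewrite (le_trans (fM x))// ltW.
Qed.

Let scaled_inf_conv f (M k : R) : (forall x, `|f x| <= M) -> 0 < k ->
  forall x y, `|k^-1 * inf_conv f k x - k^-1 * inf_conv f k y| <= `|x - y|.
Proof.
move=> fM k0 x y; rewrite -mulrBr normrM ger0_norm ?invr_ge0 ?(ltW k0)// ler_pdivrMl//.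
by apply: (inf_conv_lipschitz fM); exact: ltW.
Qed.

Let inf_convE f k : 0 < k -> inf_conv f k = (fun x => k * (k^-1 * inf_conv f k x)).
Proof. by move=> k0; apply/funext => x; rewrite mulVKf// gt_eqF. Qed.

Let measurable_inf_conv f (M k : R) : (forall x, `|f x| <= M) -> 0 < k ->
  measurable_fun setT (inf_conv f k).
Proof.
move=> fM k0; rewrite inf_convE//; apply: measurable_funM => //.
by apply: lipschitz1_measurable; exact: (scaled_inf_conv fM k0).
Qed.

(** Half of [e] pays for replacing [f] by a Lipschitz minorant under the Gaussian law, by dominated
    convergence; the other half pays for the convergence of the means of that minorant, rescaled to
    be 1-Lipschitz. Monotonicity of [mean] returns to [f]. *)
Let mean_liminf f (M e : R) : continuous f -> (forall x, `|f x| <= M) -> 0 < e ->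
  \forall n \near \oo, fine (\int[N01]_x (f x)%:E) - e <= mean n f.
Proof.
move=> cf fM e0.
have mf : measurable_fun setT f by exact: continuous_measurable_fun.
have fi := integrable_bounded mf fM.
have e2 : 0 < e / 2 by rewrite divr_gt0.
have fki (k : nat) : N01.-integrable setT (EFin \o inf_conv f k.+1%:R).
  apply: integrable_bounded; first exact: (measurable_inf_conv fM).
  by move=> x; apply: (inf_conv_bounded fM).
have ci : N01.-integrable setT (EFin \o cst M) by apply: finite_measure_integrable_cst.
have dc : (\int[N01]_x (inf_conv f k.+1%:R x)%:E)%E @[k --> \oo] --> (\int[N01]_x (f x)%:E)%E.
  have [||_ _] := @dominated_convergence _ _ _ N01 setT measurableT
    (fun (k : nat) x => (inf_conv f k.+1%:R x)%:E) (EFin \o f) (EFin \o cst M)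
    (fun k : nat => measurable_int _ (fki k)) (measurable_int _ fi) _
    ci _ => //.
  - apply: aeW => x _; apply: cvg_EFin; first by apply: nearW.
    exact: (inf_conv_cvg fM (cf x)).
  - by apply: aeW => x n _ /=; rewrite lee_fin; apply: (inf_conv_bounded fM).
pose L g := fine (\int[N01]_x (g x)%:E).
have Lc : L (inf_conv f k.+1%:R) @[k --> \oo] --> L f.
  have fE : (\int[N01]_x (f x)%:E)%E = (L f)%:E.
    by rewrite /L fineK//; exact: integrable_fin_num.
  by rewrite fE in dc; exact: fine_cvg dc.
have [k _ /(_ k (leqnn _)) Lk] := (cvgrPdist_le _ _).1 Lc _ e2.
have k0 : 0 < k.+1%:R :> R by [].
pose g := inf_conv f k.+1%:R.
have gE : g = (fun x => k.+1%:R * (k.+1%:R^-1 * g x)) by exact: inf_convE.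
have gL := scaled_inf_conv fM k0.
have mg : mean n g @[n --> \oo] --> L g.
  have -> : L g = k.+1%:R * L (fun x => k.+1%:R^-1 * g x).
    rewrite {1}gE /L; under eq_integral do rewrite EFinM.
    rewrite integralZl//; last exact: integrable_normal_lipschitz gL.
    by rewrite fineM//; apply: integrable_fin_num => //; exact: integrable_normal_lipschitz gL.
  have h1 := @mean_lipschitz (fun x => k.+1%:R^-1 * g x) gL.
  have h2 : k.+1%:R * mean n (fun x => k.+1%:R^-1 * g x) @[n --> \oo] -->
      k.+1%:R * L (fun x => k.+1%:R^-1 * g x).
    by apply: cvgM; [exact: cvg_cst|exact: h1].
  by apply: eq_cvgn h2 => n; rewrite -meanZ -gE.
have hn := (cvgrPdist_le _ _).1 mg _ e2.
near=> n.
have : `|L g - mean n g| <= e / 2 by near: n; exact: hn.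
rewrite ler_norml => /andP[_ h1]; move: Lk; rewrite ler_norml => /andP[_ h2].
have h3 : mean n g <= mean n f.
  apply: mean_le => x; have := inf_conv_le fM x x (ltW k0).
  by rewrite subrr normr0 mulr0 addr0.
rewrite -/(L f); move: h1 h2; rewrite -/g; lra.
Unshelve. all: by end_near. Qed.

(** Minorants give a lower bound only; applying it to [- f] as well supplies the upper bound. *)
Lemma lipschitz_cvg_continuous f (M : R) : continuous f -> (forall x, `|f x| <= M) ->
  mean n f @[n --> \oo] --> fine (\int[N01]_x (f x)%:E).
Proof.
move=> cf fM; apply/cvgrPdist_le => e e0.
have mf : measurable_fun setT f by exact: continuous_measurable_fun.
have cN : continuous (fun x => - f x) by move=> x; apply: cvgN; exact: cf.
have NM x : `|- f x| <= M by rewrite normrN.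
near=> n.
have h1 : fine (\int[N01]_x (f x)%:E) - e <= mean n f.
  by near: n; exact: mean_liminf fM e0.
have h2 : fine (\int[N01]_x (- f x)%:E) - e <= mean n (fun x => - f x).
  by near: n; exact: mean_liminf NM e0.
have mN : mean n (fun x => - f x) = - mean n f.
  by rewrite -mulN1r -meanZ; congr mean; apply/funext => x; rewrite mulN1r.
have LN : fine (\int[N01]_x (- f x)%:E) = - fine (\int[N01]_x (f x)%:E).
  have fi := integrable_bounded mf fM.
  transitivity (fine (\int[N01]_x ((- 1)%:E * (f x)%:E))).
    by congr fine; apply: eq_integral => x _; rewrite -EFinM mulN1r.
  by rewrite integralZl// fineM ?mulN1r//; exact: integrable_fin_num.
rewrite mN LN in h2; rewrite ler_norml; apply/andP; split; lra.
Unshelve. all: by end_near. Qed.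

End lipschitz_test_functions.

(** * The rate of convergence and the limit law *)

Lemma bern_normalized_lipschitz (R : realType) : exists2 K : R, 0 < K &
  forall (I : finType) (p : I -> R), (forall v, 0 <= p v <= 1) -> 0 < bern_var p ->
  forall h : R -> R, (forall x y, `|h x - h y| <= `|x - y|) ->
  `|bern_mean p (h \o bern_normalized p) - fine (\int[@normal_prob R 0 1]_x (h x)%:E)|
    <= K / Num.sqrt (bern_var p).
Proof.
have [K K0 stein] := stein_equation R; exists K => // I p p01 v0 h hL.
have [f [f' [df fE f'K]]] := stein h hL.
apply: le_trans (bern_stein p01 v0 df f'K).
rewrite -[X in _ - X](bern_mean_cst p) -bern_meanB le_eqVlt; apply/orP; left; apply/eqP.
by congr (`|_|); apply: eq_bern_mean => X; rewrite fE.
Qed.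

Theorem theorem2p5 (R : realType) (k0 : nat) (lambda : R)
    (hk0 : (3 <= k0)%N) (hlambda : 0 < lambda) :
  exists C : R,
    forall (d : measure_display) (Omega : measurableType d)
      (P : probability Omega R) (start : nat)
      (xi : nat -> {RV P >-> R}) (pos : nat -> {RV P >-> nat}),
      growing_walk k0 lambda start xi pos ->
    forall (d' : measure_display) (Omega' : measurableType d')
      (Q : probability Omega' R) (G : {RV Q >-> R}),
      standard_gaussian G ->
    (forall T : nat, (1 <= T)%N ->
      (wasserstein P Q (normalized_visited k0 xi pos T) G
         <= (C / Num.sqrt T%:R)%:E)%E) /\
    cvg_in_distribution P Q (normalized_visited k0 xi pos) G.
Proof.
have [K K0 hK] := bern_normalized_lipschitz R.
pose c := var_const k0 lambda / 4.
have c0 : 0 < c by rewrite divr_gt0// var_const_gt0.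
exists (K / Num.sqrt c) => d Omega P start xi pos W d' Omega' Q G Ggauss.
pose p T := @unvisited_prob R k0 lambda start T.
have main (h : R -> R) (T : nat) : (forall x y, `|h x - h y| <= `|x - y|) -> (1 <= T)%N ->
    `|bern_mean (p T) (h \o bern_normalized (p T)) -
      fine (\int[normal_prob 0 1]_x (h x)%:E)| <= K / Num.sqrt c / Num.sqrt T%:R.
  move=> hL T1; have vT := bern_var_lb hk0 hlambda T1 start.
  have cT : 0 < c * T%:R by rewrite mulr_gt0// ltr0n.
  have v0 : 0 < bern_var (p T) := lt_le_trans cT vT.
  apply: le_trans (hK _ _ (unvisited_prob01 start hlambda (T := T)) v0 h hL) _.
  rewrite -mulrA -invfM -sqrtrM ?(ltW c0)// ler_pM2l//.
  by rewrite lef_pV2 ?posrE ?sqrtr_gt0// ler_wsqrtr.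
have EP (f : R -> R) T : ('E_P[f \o normalized_visited k0 xi pos T] =
    (bern_mean (p T) (f \o bern_normalized (p T)))%:E)%E.
  by rewrite (normalized_visitedE hk0 hlambda W) -(expectation_unvisited hk0 hlambda W).
have EQ (f : R -> R) : measurable_fun setT f ->
    (normal_prob 0 1).-integrable setT (EFin \o f) ->
    ('E_Q[f \o G] = (fine (\int[normal_prob 0 1]_x (f x)%:E))%:E)%E.
  move=> mf fi; rewrite (expectation_standard_gaussian Ggauss)// fineK//.
  exact: integrable_fin_num.
split=> [T T1|f cf [M fM]].
  apply: ge_ereal_sup => _ [h hL <-].
  rewrite EP EQ; [|exact: lipschitz1_measurable|exact: integrable_normal_lipschitz].
  by rewrite -EFinB abse_EFin lee_fin; exact: main.
have mf : measurable_fun setT f by exact: continuous_measurable_fun.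
rewrite EQ//; last first.
  apply: measurable_bounded_integrable => //; first by rewrite ltey_eq fin_num_measure.
  by exists M; split; [exact: num_real|move=> N MN x _ /=]; rewrite (le_trans (fM x))// ltW.
under eq_fun do rewrite EP.
apply: cvg_EFin; first by apply: nearW.
apply: (lipschitz_cvg_continuous
  (mean := fun n g => bern_mean (p n) (g \o bern_normalized (p n)))) cf fM.
- move=> n g h gh; apply: le_bern_mean => [v|X]; last exact: gh.
  exact: unvisited_prob01.
- by move=> n k g; rewrite -bern_meanZ.
- move=> h hL; apply/cvgrPdist_le => e e0; near=> n.
  have n1 : (1 <= n)%N by near: n; exact: nbhs_infty_ge.
  rewrite distrC (le_trans (main h n hL n1))//.
  have Kc : 0 <= K / Num.sqrt c by rewrite divr_ge0 ?sqrtr_ge0// ltW.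
  rewrite ler_pdivrMr ?sqrtr_gt0 ?ltr0n// -ler_pdivrMl// mulrC.
  (* The bound falls below [e] as soon as [n] exceeds the square of this ratio. *)
  have x0 : 0 <= K / Num.sqrt c / e by rewrite divr_ge0// ltW.
  rewrite -(ger0_norm x0) -sqrtr_sqr ler_wsqrtr//.
  by near: n; exact: nbhs_infty_ger.
Unshelve. all: by end_near. Qed.
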